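(* Let $G$ be a countable, discrete, sofic group with sofic approximation $\sigma_k\colon G\to S_{d_k}$. Let $G\curvearrowright X$ be an algebraic action and let $\rho$ be a compatible metric on $X$. The following are equivalent: (i) There does not exist a sequence $\mu_k\in\mathrm{Prob}(X^{d_k})$ which is asymptotically supported on topological microstates and which locally weak$^*$-converges to $m_X$ as $k\to\infty$. (ii) There is a $G$-invariant $\eta\in\mathrm{Prob}(\mathrm{Sub}(X))$ with $\eta\neq\delta_X$, and a sequence $(Y_k)_k\in\prod_k\mathrm{Sub}(X)^{d_k}$ which satisfies the following property. Given any sequence $(\phi_k)_k$ of topological microstates, there is an increasing sequence of natural numbers $(k_l)_l$ so that $\lim_{l\to\infty}(Y_{k_l})_*(u_{d_{k_l}})=\eta$ (weak$^*$), and \[\lim_{l\to\infty}\frac1{d_{k_l}}\sum_{j=1}^{d_{k_l}}\rho(\phi_{k_l}(j),Y_{k_l}(j))=0.\]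
   Context: $S_n$ is the symmetric group on $\{1,\dots,n\}$, $u_n$ the uniform probability measure on $\{1,\dots,n\}$, $d_{\mathrm{Hamm}}(p,q)=u_n(\{j:p(j)\ne q(j)\})$. A sofic approximation of $G$ is a sequence of maps $\sigma_k\colon G\to S_{d_k}$ (not necessarily homomorphisms) with $d_k\to\infty$, $d_{\mathrm{Hamm}}(\sigma_k(gh),\sigma_k(g)\sigma_k(h))\to 0$ for all $g,h$ and $d_{\mathrm{Hamm}}(\sigma_k(g),\sigma_k(h))\to 1$ for $g\neq h$. An algebraic action is an action by continuous automorphisms of a compact metrizable group $X$; $m_X$ is the Haar probability measure. $\mathrm{Sub}(X)$ is the space of closed subgroups of $X$ with the Hausdorff-metric topology and the induced $G$-action; $\delta_X$ is the point mass at $X\in\mathrm{Sub}(X)$. $A^n$ is identified with maps $\{1,\dots,n\}\to A$, and $\rho(x,K)=\inf_{y\in K}\rho(x,y)$. For $\nu\in\mathrm{Prob}(X^{d})$, $\nu_j\in\mathrm{Prob}(X)$ is its $j$-th marginal. $(\mu_k)_k\in\prod_k\mathrm{Prob}(X^{d_k})$ is asymptotically supported on topological microstates if for all $g\in G$, $\delta>0$ and every neighborhood $U$ of the diagonal in $X\times X$, $\lim_{k\to\infty}\mu_k(\{\phi:u_{d_k}(\{j:(\phi(\sigma_k(g)(j)),g\phi(j))\in U\})\ge1-\delta\})=1$. $\mu_k$ locally weak$^*$-converges to $\mu\in\mathrm{Prob}(X)$ as $k\to\infty$ if $\lim_{k\to\infty}u_{d_k}(\{j:\mu_{k,j}\in\mathcal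 O\})=1$ for every weak$^*$ neighborhood $\mathcal O$ of $\mu$. A sequence $(\phi_k)_k\in\prod_kX^{d_k}$ is a sequence of topological microstates if $\lim_{k\to\infty}u_{d_k}(\{j:(g\phi_k(j),\phi_k(\sigma_k(g)(j)))\in U\})=1$ for every $g\in G$ and every neighborhood $U$ of the diagonal. *)

(* Defs.v *)
From HB Require Import structures.
From mathcomp Require Import all_boot all_order all_algebra perm.
From mathcomp Require Import all_classical all_reals all_analysis.

Set Implicit Arguments.
Unset Strict Implicit.
Unset Printing Implicit Defensive.

Import Order.TTheory GRing.Theory Num.Theory.
Import numFieldNormedType.Exports.

Local Open Scope classical_set_scope.
Local Open Scope ring_scope.

(* A compact metrizable group together with a compatible metric [mdist].  The
   base point is arbitrary; it is there only because the library equips just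
   pointed types with sigma-algebras. *)
HB.mixin Record Metric_isCompactGroup (R : realType) X
    & Group X & Metric R X := {
  mulg_continuous : continuous (fun p : X * X => (p.1 * p.2)%g) ;
  invg_continuous : continuous (fun x : X => x^-1%g) ;
  compact_groupT : compact [set: X]
}.

#[short(type="compactMetricGroupType")]
HB.structure Definition CompactMetricGroup (R : realType) :=
  {X of Group X & Pointed X & Metric R X & Metric_isCompactGroup R X}.

HB.instance Definition _ (I : Type) (T : I -> ptopologicalType) :=
  isPointed.Build (prod_topology T) (fun=> point).

Section finite_uniform.
Variable R : realType.

(* the value [u_n(A)] of the uniform probability on [n] points *)
Definition unif n (A : set 'I_n) : R := #|[pred j | `[< A j >]]|%:R / n%:R.

Definition dHamm n (p q : 'S_n) : R := unif [set j | p j <> q j].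

End finite_uniform.

Section probabilities.
Variable R : realType.

Definition borel (T : ptopologicalType) := g_sigma_algebraType (@open T).

HB.instance Definition _ (T : ptopologicalType) := Measurable.on (borel T).

Definition Prob (T : ptopologicalType) := probability (borel T) R.

(* The weak* topology: the coarsest one making every evaluation
   [mu |-> \int f dmu], with [f] real and continuous, continuous.  It is only
   used for compact [T], where all these [f] are bounded. *)
Definition integrals (T : ptopologicalType) (mu : Prob T) :
    {ptws continuousType T R -> R} :=
  fun f => \int[mu]_x f x.

HB.instance Definition _ (T : ptopologicalType) :=
  Topological.copy (Prob T) (initial_topology (@integrals T)).

Definition point_mass (T : ptopologicalType) (x : T) : Prob T :=
  dirac (x : borel T).

(* A [probability] also carries (meaningless) values on non-measurable sets,
   hence equality of measures is not Leibniz equality. *)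
Definition same_measure (T : ptopologicalType) (mu nu : Prob T) :=
  forall A : set (borel T), measurable A -> mu A = nu A.

Lemma continuous_borel (S T : ptopologicalType) (f : S -> T) :
  continuous f -> measurable_fun [set: borel S] (f : borel S -> borel T).
Proof.
move=> cf; apply: (@measurability _ _ (borel S) (borel T) setT f (@open T)).
  by [].
move=> _ [U oU <-]; rewrite setTI; apply: sub_sigma_algebra.
by move/continuousP: cf; exact.
Qed.

Section marginal.
Variables (T : ptopologicalType) (n : nat) (j : 'I_n).

Definition coord (phi : borel {ptws 'I_n -> T}) : borel T := phi j.

Let coord_measurable : measurable_fun setT coord.
Proof.
by apply: (@continuous_borel {ptws 'I_n -> T}); exact: proj_continuous.
Qed.

HB.instance Definition _ :=
  isMeasurableFun.Build _ _ _ _ coord coord_measurable.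

Definition marginal (mu : Prob {ptws 'I_n -> T}) : Prob T :=
  distribution mu coord.

End marginal.

Section pushforward_unif.
Variables (T : ptopologicalType) (n : nat).

Definition pushforward_unif of (0 < n)%N := fun (Y : 'I_n -> T)
  (A : set (borel T)) => (unif R (Y @^-1` A))%:E.

Variables (n_gt0 : (0 < n)%N) (Y : 'I_n -> T).
Local Notation nu := (pushforward_unif n_gt0 Y).

Let invn_ge0 : 0 <= n%:R^-1 :> R. Proof. by rewrite invr_ge0. Qed.

Let m (k : nat) : {measure set (borel T) -> \bar R} :=
  mscale (NngNum invn_ge0) (dirac (Y (insubd (Ordinal n_gt0) k) : borel T)).

Let nuE : nu = msum m n.
Proof.
apply/funext => A; rewrite /pushforward_unif /msum /m /mscale /= /dirac.
rewrite (eq_bigr (fun k : 'I_n => (n%:R^-1 *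
    \1_A (Y (insubd (Ordinal n_gt0) (k : nat)) : borel T))%:E)) //.
rewrite sumEFin -mulr_sumr mulrC /unif; congr (_ * _)%:E.
rewrite -sum1_card natr_sum big_mkcond /=; apply: eq_bigr => j _.
rewrite indicE (_ : insubd _ _ = j); last first.
  by apply: val_inj; rewrite insubdK//; exact: ltn_ord.
by rewrite inE; case: asboolP => Aj; [rewrite mem_set|rewrite memNset].
Qed.

Let nu0 : nu set0 = 0%E. Proof. by rewrite nuE measure0. Qed.

Let nu_ge0 A : (0 <= nu A)%E. Proof. by rewrite nuE measure_ge0. Qed.

Let nu_sigma_additive : semi_sigma_additive nu.
Proof. by rewrite nuE; exact: measure_semi_sigma_additive. Qed.

HB.instance Definition _ := isMeasure.Build _ _ _ nu
  nu0 nu_ge0 nu_sigma_additive.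

Let nu_setT : nu setT = 1%E.
Proof.
rewrite /pushforward_unif /unif preimage_setT.
have -> : #|[pred j : 'I_n | `[< [set: 'I_n] j >]]| = n.
  by rewrite -[RHS]card_ord; apply: eq_card => j; rewrite !inE; apply/asboolP.
by rewrite divff// pnatr_eq0 -lt0n.
Qed.

HB.instance Definition _ := Measure_isProbability.Build _ _ _ nu nu_setT.

End pushforward_unif.

(* the measure [Y_* u_n] *)
Definition empirical (T : ptopologicalType) n (n_gt0 : (0 < n)%N)
  (Y : 'I_n -> T) : Prob T := pushforward_unif n_gt0 Y.

End probabilities.

Section distances.
Variables (R : realType) (X : metricType R).
Implicit Types (x y : X) (K : set X).

Definition setdist x K : R := inf [set mdist x y | y in K].

Definition hausdorff_dist K L : R :=
  Num.max (sup [set setdist x L | x in K]) (sup [set setdist y K | y in L]).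

Lemma setdist_ge0 x K : 0 <= setdist x K.
Proof.
have [->|/set0P K0] := eqVneq K set0; first by rewrite /setdist image_set0 inf0.
by apply: lb_le_inf; [exact: image_nonempty|move=> _ [y _ <-]; exact: mdist_ge0].
Qed.

Lemma setdist_le x y K : K y -> setdist x K <= mdist x y.
Proof.
move=> Ky; apply: ge_inf; last by exists y.
by exists 0 => _ [z _ <-]; exact: mdist_ge0.
Qed.

Lemma setdist_lt x K e : K !=set0 -> setdist x K < e ->
  exists2 y, K y & mdist x y < e.
Proof.
move=> K0 /inf_lt [|_ [y Ky <-] xye]; [exact: image_nonempty|by exists y].
Qed.

Lemma setdist_triangle x y K : K !=set0 ->
  setdist x K <= mdist x y + setdist y K.
Proof.
move=> K0; apply/ler_addgt0Pr => e e0.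
have [|z Kz yz] := @setdist_lt y K (setdist y K + e) K0; first by rewrite ltrDl.
rewrite (le_trans (setdist_le x Kz))// (le_trans (metric_triangle x y z))//.
by rewrite -addrA lerD2l ltW.
Qed.

Lemma setdist_eq0 x K : K !=set0 -> closed K -> setdist x K = 0 -> K x.
Proof.
move=> K0 cK xK0; apply: cK => U /nbhs_ballP[e /= e0 xeU].
have [|y Ky xy] := @setdist_lt x K e K0; first by rewrite xK0.
by exists y; split => //; apply: xeU; rewrite ballEmdist.
Qed.

End distances.

Section closed_subgroups.
Variables (R : realType) (X : compactMetricGroupType R).

Definition closed_subgroup (H : set X) :=
  [/\ closed H, H 1%g, forall x y, H x -> H y -> H (x * y)%g &
      forall x, H x -> H x^-1%g].

Record closedSubgroup :=
  ClosedSubgroup { sub_set :> set X ; sub_setP : closed_subgroup sub_set }.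

Implicit Types H K L : closedSubgroup.

Lemma sub_set_inj : injective sub_set.
Proof.
case=> [H hH] [K hK] /= HK; move: hK; rewrite -HK => hK.
by rewrite (Prop_irrelevance hH hK).
Qed.

Lemma closed_sub H : closed H. Proof. by case: (sub_setP H). Qed.

Lemma sub_neq0 H : (H : set X) !=set0.
Proof. by exists 1%g; case: (sub_setP H). Qed.

Lemma closed_subgroup_setT : closed_subgroup [set: X].
Proof. by split => //; exact: closedT. Qed.

Definition full_subgroup := ClosedSubgroup closed_subgroup_setT.

Lemma mdist_bounded : exists M, forall x y : X, mdist x y <= M.
Proof.
have cd : continuous (mdist (1%g : X) : X -> R).
  move=> y; apply/cvgrPdist_lt => e e0; near=> z.
  have : mdist y z < e.
    near: z; apply/nbhs_ballP; exists e => // z; by rewrite ballEmdist.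
  apply: le_lt_trans; rewrite ler_norml; apply/andP; split.
    by rewrite lerBrDl lerBlDr metric_triangle.
  by rewrite lerBlDl [mdist y z]metric_sym metric_triangle.
have [x _ Mx] := @compact_EVT_max X R (mdist 1%g) setT
  (ex_intro _ 1%g I) compact_groupT (continuous_subspaceT cd).
exists (mdist 1%g x + mdist 1%g x) => y z.
rewrite (le_trans (metric_triangle y 1%g z))// lerD//; last exact/Mx/in_setT.
by rewrite metric_sym; exact/Mx/in_setT.
Unshelve. all: by end_near. Qed.

Lemma setdist_hausdorff H K x :
  sub_set H x -> setdist x K <= sup [set setdist x K | x in (H : set X)].
Proof.
move=> Hx; apply: ub_le_sup; last by exists x.
have [M dM] := mdist_bounded; exists M => _ [y _ <-].
have [z Kz] := sub_neq0 K.
exact: le_trans (setdist_le y Kz) (dM _ _).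
Qed.

Let dist H K : R := hausdorff_dist H K.

Lemma setdist_hausdorff_dist H K x : sub_set H x -> setdist x K <= dist H K.
Proof. by move=> Hx; rewrite le_max setdist_hausdorff. Qed.

Let dist_sym H K : dist H K = dist K H.
Proof. by rewrite /dist /hausdorff_dist maxC. Qed.

Lemma hausdorff_dist_le H K (e : R) :
  (forall x, sub_set H x -> setdist x K <= e) -> (forall x, sub_set K x -> setdist x H <= e) ->
  dist H K <= e.
Proof.
move=> HK KH; rewrite ge_max; apply/andP; split.
- by apply: ge_sup => [|_ [x Hx <-]]; [exact/image_nonempty/sub_neq0|exact: HK].
- by apply: ge_sup => [|_ [x Hx <-]]; [exact/image_nonempty/sub_neq0|exact: KH].
Qed.

Let dist_ge0 H K : 0 <= dist H K.
Proof.
have [x Hx] := sub_neq0 H.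
exact: le_trans (setdist_ge0 x K) (setdist_hausdorff_dist K Hx).
Qed.

Let distxx H : dist H H = 0.
Proof.
apply/eqP; rewrite eq_le dist_ge0 andbT.
by apply: hausdorff_dist_le => x Hx;
  rewrite (le_trans (setdist_le x Hx))// mdistxx.
Qed.

Let dist0_sub H K : dist H K = 0 -> H `<=` K.
Proof.
move=> HK x Hx; apply: setdist_eq0; [exact: sub_neq0|exact: closed_sub|].
by apply/eqP; rewrite eq_le setdist_ge0 andbT -HK setdist_hausdorff_dist.
Qed.

Let dist_positivity H K : dist H K = 0 -> H = K.
Proof.
move=> HK; apply: sub_set_inj; apply/seteqP; split; apply: dist0_sub => //.
by rewrite dist_sym.
Qed.

Let setdist_dist K H L x : sub_set H x -> setdist x L <= dist H K + dist K L.
Proof.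
move=> Hx; apply/ler_addgt0Pr => e e0.
have [|y Ky xy] := @setdist_lt _ _ x K (dist H K + e) (sub_neq0 K).
  by rewrite (le_lt_trans (setdist_hausdorff_dist K Hx))// ltrDl.
rewrite (le_trans (setdist_triangle x y (sub_neq0 L)))//.
by rewrite addrAC lerD ?setdist_hausdorff_dist// ltW.
Qed.

Let dist_triangle K H L : dist H L <= dist H K + dist K L.
Proof.
apply: hausdorff_dist_le => x; first exact: setdist_dist.
by move=> /(setdist_dist K H); rewrite addrC (dist_sym L) (dist_sym K).
Qed.

HB.instance Definition _ := gen_eqMixin closedSubgroup.
HB.instance Definition _ := gen_choiceMixin closedSubgroup.
HB.instance Definition _ := isPointed.Build closedSubgroup full_subgroup.
HB.instance Definition _ := isMetric.Build R closedSubgroup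
  distxx dist_positivity dist_sym dist_triangle.

End closed_subgroups.

(* On a compact group there is exactly one left-invariant Borel probability. *)
Definition haar (R : realType) (X : compactMetricGroupType R) (m : Prob R X) :=
  forall (x : X) (A : set (borel X)), measurable A ->
    pushforward m (fun y : borel X => (x * y)%g : borel X) A = m A.

Section actions.
Variables (G : groupType) (R : realType) (X : compactMetricGroupType R).

Record algebraic_action (a : G -> X -> X) : Prop := AlgebraicAction {
  act1 : forall x, a 1%g x = x ;
  actM : forall g h x, a (g * h)%g x = a g (a h x) ;
  act_morph : forall g, {morph a g : x y / (x * y)%g} ;
  act_continuous : forall g, continuous (a g)
}.

Variables (a : G -> X -> X) (ha : algebraic_action a).

Lemma act_closed_subgroup g (H : closedSubgroup X) :
  closed_subgroup (a g @` H).
Proof.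
have aK : cancel (a g) (a g^-1%g).
  by move=> x; rewrite -(actM ha) mulVg (act1 ha).
have aVK : cancel (a g^-1%g) (a g).
  by move=> x; rewrite -(actM ha) mulgV (act1 ha).
have a1 : a g 1%g = 1%g.
  by apply: (mulgI (a g 1%g)); rewrite -(act_morph ha) !mulg1.
case: (sub_setP H) => cH H1 HM HV; split.
- rewrite (_ : _ @` _ = a g^-1%g @^-1` H).
    by have /continuous_closedP := @act_continuous _ ha g^-1%g; exact.
  apply/seteqP; split => [_ [x Hx <-]|x Hx] /=; first by rewrite aK.
  by exists (a g^-1%g x).
- by exists 1%g.
- move=> _ _ [x Hx <-] [y Hy <-]; exists (x * y)%g; first exact: HM.
  exact: act_morph.
- move=> _ [x Hx <-]; exists x^-1%g; first exact: HV.
  by apply: (mulgI (a g x)); rewrite -(act_morph ha) !mulgV.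
Qed.

Definition sub_act g H : closedSubgroup X :=
  ClosedSubgroup (act_closed_subgroup g H).

Definition invariant (eta : Prob R (closedSubgroup X)) :=
  forall g (A : set (borel (closedSubgroup X))), measurable A ->
    pushforward eta (sub_act g : borel _ -> borel _) A = eta A.

End actions.

Section sofic.
Variables (R : realType) (G : groupType) (d : nat -> nat).
Variable sigma : forall k, G -> 'S_(d k).

(* Permutations multiply in diagrammatic order: [(p * q) j = q (p j)], so the
   usual composition of [sigma k g] after [sigma k h] is
   [sigma k h * sigma k g]. *)
Record sofic_approximation : Prop := SoficApproximation {
  sofic_dim : d @ \oo --> \oo ;
  sofic_mul : forall g h, (fun k =>
    dHamm R (sigma k (g * h)%g) (sigma k h * sigma k g)%g) @ \oo --> (0 : R) ;
  sofic_neq : forall g h, g <> h ->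
    (fun k => dHamm R (sigma k g) (sigma k h)) @ \oo --> (1 : R)
}.

Variables (X : compactMetricGroupType R) (a : G -> X -> X).

Definition topological_microstates (phi : forall k, 'I_(d k) -> X) :=
  forall (g : G) (U : set (X * X)), (forall x : X, nbhs (x, x) U) ->
    (fun k => unif R [set j | U (a g (phi k j), phi k (sigma k g j))])
      @ \oo --> (1 : R).

(* [U] is taken open so that the set of [phi] below is Borel; this loses
   nothing, since every neighbourhood of the diagonal contains an open one. *)
Definition supported_on_microstates
    (mu : forall k, Prob R {ptws 'I_(d k) -> X}) :=
  forall (g : G) (delta : R) (U : set (X * X)),
    0 < delta -> open U -> (forall x : X, U (x, x)) ->
    (fun k => mu k [set phi : {ptws 'I_(d k) -> X} |
       unif R [set j | U (phi (sigma k g j), a g (phi j))] >= 1 - delta])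
      @ \oo --> (1%E : \bar R).

Definition locally_weakstar_cvg (mu : forall k, Prob R {ptws 'I_(d k) -> X})
    (m : Prob R X) :=
  forall O : set (Prob R X), nbhs m O ->
    (fun k => unif R [set j | O (marginal j (mu k))]) @ \oo --> (1 : R).

End sofic.

(* Main.v *)
(** The idea.  (i) => (ii).  The pointwise product of two microstates is a
    microstate, and so are inverses.  If a bounded number of microstates takes,
    at most indices, values that are dense in [X] at a small scale, then the
    uniform measure on the words of a fixed large length in them is close to
    Haar measure there (Doeblin).  By (i) this is impossible along infinitely
    many [k], hence along an ultrafilter of [k].  There, for every scale, choose a
    bounded list of microstates hitting as many balls of a finite net as
    possible, on average over the indices: any further microstate takes its
    values near those of the list.  Applied to quotients of the members, this
    makes the set of values at [j] an approximate subgroup, hence close to a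
    closed subgroup [Y_k(j)].  As the lists are bounded, [j |-> Y_k(j)] is
    approximately equivariant, so a weak* limit of the empirical measures is
    invariant, and it is not [delta_X] because the values are not dense.

    (ii) => (i).  Given [mu_k] as in (i), the [mu_k]-mean of
    [phi |-> d_k^-1 sum_j rho(phi(j), Y_k(j))] is asymptotically the mean over [j]
    of [F(Y_k(j))], where [F(H)] is the integral of [rho(x, H)] against Haar
    measure.  So some microstates do at least as well; along the subsequence that
    (ii) gives for them, this tends to [0] and yet to the integral of [F] against
    [eta], which is positive since [F > 0] off [X] and [eta <> delta_X]. *)
From HB Require Import structures.
From mathcomp Require Import all_boot all_order all_algebra perm.
From mathcomp Require Import all_classical all_reals all_analysis.
From mathcomp Require Import measurable_realfun.
From mathcomp Require Import lra.
Require Import Defs.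

Set Implicit Arguments.
Unset Strict Implicit.
Unset Printing Implicit Defensive.

Import Order.TTheory GRing.Theory Num.Theory.
Import numFieldNormedType.Exports.

Local Open Scope classical_set_scope.
Local Open Scope ring_scope.

(** What shapes (i) => (ii) is the order of the choices. A sequence of topological microstates meets
    a fixed accuracy only from some [k] on, so the accuracy [q] asked of the microstates that a
    scale is tested on must not grow along the subsequence. On the other hand, moving the values of
    [N] microstates by a group element spoils a proportion of indices of order [N / n], where [n] is
    the accuracy of the list, so [n] has to come after [N]. Both demands are met because the size of
    a maximal list is fixed first, for lists that exist at every accuracy: [q] then depends on the
    number of test microstates, and [n] stays free. The number of balls hit is bounded by the size
    of the net, so a near-supremum exists; the ultrafilter turns the failure to exceed it into a
    failure at most [k]. Finally one subsequence serves all sequences of microstates.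

    In (ii) => (i) the microstates must be accurate and do well on the mean at the same time; both
    follow from one inequality integrated against [mu k]. *)

(** * Proportions and means over the indices *)

Section finite_uniform_theory.
Variables (R : realType) (n : nat).
Implicit Types A B : set 'I_n.

Lemma unif_ge0 A : 0 <= unif R A.
Proof. by rewrite /unif divr_ge0. Qed.

Lemma le_unif A B : A `<=` B -> unif R A <= unif R B.
Proof.
move=> AB; rewrite /unif ler_wpM2r ?invr_ge0// ler_nat.
apply/subset_leq_card/fintype.subsetP => j; rewrite !inE; exact: AB.
Qed.

Lemma unif_sum A : unif R A = n%:R^-1 * \sum_(j < n) (`[< A j >] : nat)%:R.
Proof.
rewrite /unif mulrC -sum1_card natr_sum big_mkcond/=; congr (_ * _).
by apply: eq_bigr => j _; rewrite inE; case: asboolP.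
Qed.

Lemma unifU A B : unif R (A `|` B) <= unif R A + unif R B.
Proof.
rewrite !unif_sum -mulrDr ler_wpM2l ?invr_ge0// -big_split/=.
apply: ler_sum => j _; rewrite -natrD ler_nat.
by do 3 case: asboolP => //=; move=> ? ? [].
Qed.

Lemma unif_set0 : unif R (set0 : set 'I_n) = 0.
Proof.
rewrite unif_sum big1 ?mulr0// => j _.
by case: asboolP.
Qed.

Lemma unif_perm (p : 'S_n) A : unif R (p @^-1` A) = unif R A.
Proof.
rewrite !unif_sum; congr (_ * _).
by rewrite [RHS](reindex_inj (@perm_inj _ p)).
Qed.

Lemma unif_exists (I : eqType) (s : seq I) (B : I -> set 'I_n) (c : R) :
  (forall i, i \in s -> unif R (B i) <= c) ->
  unif R [set j | exists2 i, i \in s & B i j] <= (size s)%:R * c.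
Proof.
elim: s => [|i s ih] Bc /=.
  rewrite mul0r (_ : mkset _ = set0) ?unif_set0//.
  by rewrite -subset0 => j [].
rewrite -add1n natrD mulrDl mul1r.
apply: le_trans (lerD (Bc i (mem_head _ _)) (ih _)); last first.
  by move=> k ks; apply: Bc; rewrite inE ks orbT.
apply: le_trans (unifU _ _); apply: le_unif => j [k].
by rewrite inE => /predU1P[->|ks] Bkj; [left|right; exists k].
Qed.

Hypothesis n_gt0 : (0 < n)%N.

Lemma mean_const (c : R) : n%:R^-1 * (\sum_(j < n) c) = c.
Proof.
by rewrite sumr_const card_ord -[c *+ n]mulr_natl mulKf// pnatr_eq0 -lt0n.
Qed.

Lemma unif_setT : unif R [set: 'I_n] = 1.
Proof.
rewrite unif_sum -[RHS]mean_const; congr (_ * _).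
by apply: eq_bigr => j _; rewrite asboolT.
Qed.

Lemma unif_le1 A : unif R A <= 1.
Proof. by rewrite -unif_setT; exact: le_unif. Qed.

Lemma unifC A : unif R (~` A) = 1 - unif R A.
Proof.
apply/eqP; rewrite -subr_eq opprK; apply/eqP.
rewrite -unif_setT !unif_sum -mulrDr -big_split.
congr (_ * _); apply: eq_bigr => j _ /=; rewrite -natrD.
rewrite [in RHS]asboolT// asbool_neg.
by case: asboolP.
Qed.

Lemma mean_le (f : 'I_n -> R) (B : set 'I_n) (e M : R) : 0 <= e ->
  (forall j, f j <= M) -> (forall j, ~ B j -> f j <= e) ->
  n%:R^-1 * (\sum_(j < n) f j) <= e + `|M| * unif R B.
Proof.
move=> e0 fM fe; rewrite -[e in leRHS]mean_const unif_sum mulrCA -mulrDr.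
rewrite ler_wpM2l ?invr_ge0// mulr_sumr -big_split/=; apply: ler_sum => j _.
case: asboolP => Bj; last by rewrite mulr0 addr0 fe.
by rewrite mulr1 (le_trans (fM _))// (le_trans (ler_norm _))// lerDr.
Qed.

Lemma unif_markov (f : 'I_n -> R) (e : R) : (forall j, 0 <= f j) ->
  e * unif R [set j | e <= f j] <= n%:R^-1 * (\sum_(j < n) f j).
Proof.
move=> f0; rewrite unif_sum mulrCA ler_wpM2l ?invr_ge0// mulr_sumr.
apply: ler_sum => j _.
by case: asboolP => [fj|_]; [rewrite mulr1|rewrite mulr0].
Qed.

End finite_uniform_theory.

(** * Diagonal choices and subsequences *)

Section sequences_tools.

(** At [k] the strongest satisfiable condition among the first [k] is realised; a fixed [n] is
    eventually among them and satisfiable. *)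
Lemma diagonal (T : nat -> Type) (t0 : forall k, T k)
    (P : nat -> forall k, T k -> Prop) :
  (forall n k x, P n.+1 k x -> P n k x) ->
  (forall n, \forall k \near \oo, exists x, P n k x) ->
  exists x : forall k, T k, forall n, \forall k \near \oo, P n k (x k).
Proof.
move=> Pdec Pex.
have Ple m n k x : (m <= n)%N -> P n k x -> P m k x.
  move=> /subnK <-; elim: (n - m)%N => // i ih; rewrite addSn => /Pdec.
  exact: ih.
have best k : exists x, forall n, (n <= k)%N -> (exists y, P n k y) -> P n k x.
  suff H : forall l, exists x, forall n, (n <= l)%N -> (exists y, P n k y) ->
      P n k x by exact: H.
  elim=> [|l [x xP]].
    have [[y Py]|nP] := pselect (exists y, P 0%N k y).
      by exists y => n; rewrite leqn0 => /eqP->.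
    by exists (t0 k) => n; rewrite leqn0 => /eqP->.
  have [[y Py]|nP] := pselect (exists y, P l.+1 k y).
    by exists y => n nl _; exact: Ple nl Py.
  exists x => n; rewrite leq_eqVlt => /predU1P[->//|]; rewrite ltnS; exact: xP.
exists (fun k => projT1 (cid (best k))) => n; near=> k.
case: cid => x /= xP; apply: xP; first by near: k; exact: nbhs_infty_ge.
by near: k; exact: Pex.
Unshelve. all: by end_near. Qed.

Lemma frequently_subsequence (P : nat -> nat -> Prop) :
  (forall l N, exists k, (N <= k)%N /\ P l k) ->
  exists s : nat -> nat, {homo s : l m / (l < m)%N} /\ forall l, P l (s l).
Proof.
move=> Pex.
pose next l N := projT1 (cid (Pex l N)).
have nextP l N : (N <= next l N)%N /\ P l (next l N) by rewrite /next; case: cid.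
pose s := fix s l := if l is m.+1 then next l (s m).+1 else next 0%N 0%N.
exists s; split; last by case=> [|l]; exact: (nextP _ _).2.
apply: homo_ltn => l; first exact: ltn_trans.
exact: (nextP l.+1 (s l).+1).1.
Qed.

Lemma invS_lt (R : realType) (e : R) : 0 < e ->
  exists n, forall m, (n <= m)%N -> m.+1%:R^-1 < e.
Proof.
move=> e0; exists (Num.truncn e^-1) => m nm.
rewrite invf_plt ?posrE//; apply: lt_le_trans (truncnS_gt _) _.
by rewrite ler_nat.
Qed.

End sequences_tools.

(** * Uniformity on compact metric spaces and groups *)

Section compact_metric.
Variable R : realType.

(** A Lebesgue number: around each point one radius works locally, and compactness makes it
    global. *)
Lemma diagonal_ball (X : pseudoMetricType R) (U : set (X * X)) :
  compact [set: X] -> (forall x : X, nbhs (x, x) U) ->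
  exists2 d : R, 0 < d & forall x y, ball x d y -> U (x, y).
Proof.
move=> /compact_near_coveringP cX nU.
have : \forall e \near (0:R)^'+,
    [set: X] `<=` [set x | forall y, ball x e y -> U (x, y)].
  apply: (cX _ _ (fun e x => forall y, ball x e y -> U (x, y))) => x _.
  have [[A B] [/= /nbhs_ballP[r1 /= r10 A1] /nbhs_ballP[r2/= r20 B1]] AB] := nU x.
  exists (A `&` ball x (r2 / 2), [set e | 0 < e < r2 / 2]).
    split; last first.
      near=> e; rewrite /mkset; apply/andP; split; near: e.
        exact: nbhs_right_gt.
      by apply: nbhs_right_lt; rewrite divr_gt0.
    apply: filterI; apply/nbhs_ballP; first by exists r1.
    by exists (r2 / 2) => //=; rewrite divr_gt0.
  move=> [z e]/= [[Az xz] /andP[e0 er]] y zy.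
  apply: AB; split => //; apply: B1.
  by apply: (ball_split xz); apply: le_ball zy; exact: ltW.
move=> H.
have [e [e0 eU]] : exists e : R, 0 < e /\
    [set: X] `<=` [set x | forall y, ball x e y -> U (x, y)].
  have /filter_ex[e [? ?]] : \forall e \near (0:R)^'+, 0 < e /\
    [set: X] `<=` [set x | forall y, ball x e y -> U (x, y)].
    by apply: filterI => //; exact: nbhs_right_gt.
  by exists e.
by exists e => // x y; exact: eU.
Unshelve. all: by end_near. Qed.

Lemma uniform_continuity (X Y : pseudoMetricType R) (f : X -> Y) (e : R) :
  compact [set: X] -> continuous f -> 0 < e ->
  exists2 d, 0 < d & forall x y, ball x d y -> ball (f x) e (f y).
Proof.
move=> cX cf e0.
apply: (@diagonal_ball X [set p | ball (f p.1) e (f p.2)]) => // x.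
have /cf fx : nbhs (f x) (ball (f x) (e / 2)) by apply: nbhsx_ballx; rewrite divr_gt0.
exists (f @^-1` ball (f x) (e / 2), f @^-1` ball (f x) (e / 2)) => // -[y z]/= [xy xz].
by apply: (ball_splitr xy xz).
Qed.

Lemma finite_net (X : pseudoPMetricType R) (e : R) :
  compact [set: X] -> 0 < e ->
  exists s : seq X, forall x, exists2 c, c \in s & ball c e x.
Proof.
move=> cX e0; have {cX}: cover_compact [set: X] by rewrite -compact_cover.
move=> cX.
have [D _ Dcov] := cX X [set: X] (fun x => (ball x e)^°) (fun x _ => open_interior _)
  (fun x _ => ex_intro2 _ _ x I (nbhsx_ballx _ _ e0)).
exists (finmap.enum_fset D) => x.
have [c cD /interior_subset xc] := Dcov x I.
by exists c.
Qed.

End compact_metric.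

Section compact_group.
Variables (R : realType) (X : compactMetricGroupType R).

Lemma mdist_uniform_continuity (Y Z : metricType R) (f : Y -> Z) (e : R) :
  compact [set: Y] -> continuous f -> 0 < e ->
  exists2 d, 0 < d & forall x y, mdist x y < d -> mdist (f x) (f y) < e.
Proof.
move=> cY cf e0; have [d d0 fd] := uniform_continuity cY cf e0.
by exists d => // x y xy; have := fd x y; rewrite !ballEmdist; exact.
Qed.

Lemma diagonal_mdist (Y : metricType R) (U : set (Y * Y)) :
  compact [set: Y] -> (forall x : Y, nbhs (x, x) U) ->
  exists2 d : R, 0 < d & forall x y, mdist x y < d -> U (x, y).
Proof.
move=> cY nU; have [d d0 Ud] := diagonal_ball cY nU.
by exists d => // x y xy; apply: Ud; rewrite ballEmdist.
Qed.

Lemma divg_uniform (e : R) : 0 < e -> exists2 d, 0 < d &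
  forall x y x' y' : X, mdist x x' < d -> mdist y y' < d ->
    mdist (x * y^-1)%g (x' * y'^-1)%g < e.
Proof.
move=> e0; pose f (p : X * X) : X := (p.1 * p.2^-1)%g.
have cf : continuous f.
  move=> p.
  apply: (@continuous_comp _ _ _ (fun p : X * X => (p.1, p.2^-1)%g)
    (fun p : X * X => (p.1 * p.2)%g)); last exact: mulg_continuous.
  apply: (@cvg_pair _ _ _ (nbhs p) (nbhs p.1) (nbhs p.2^-1%g)); first exact: cvg_fst.
  apply: continuous_comp; [exact: cvg_snd|exact: invg_continuous].
have cXX : compact [set: X * X].
  by rewrite -setXTT; apply: compact_setX; exact: compact_groupT.
have [d d0 fd] := uniform_continuity cXX cf e0.
exists d => // x y x' y' xx' yy'; have := fd (x, y) (x', y').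
rewrite /f/= ballEmdist; apply.
by split; rewrite /= ballEmdist.
Qed.

(** The modulus is uniform in the left factor [x]; this replaces a left-invariant metric, as [mdist]
    is an arbitrary compatible one. *)
Lemma mulg_uniform (e : R) : 0 < e -> exists2 d, 0 < d &
  forall x y y' : X, mdist y y' < d -> mdist (x * y)%g (x * y')%g < e.
Proof.
move=> e0; have [d1 d10 H1] := divg_uniform e0.
have [d d0 H] := divg_uniform d10.
exists d => // x y y' yy'.
have := H1 x y^-1%g x y'^-1%g; rewrite !invgK mdistxx; apply => //.
by have := H 1%g y 1%g y'; rewrite !mul1g mdistxx; exact.
Qed.

End compact_group.

Lemma near_forall_leq (T : Type) (F : set_system T) (P : nat -> T -> Prop) n :
  Filter F -> (forall i, \forall k \near F, P i k) ->
  \forall k \near F, forall i, (i <= n)%N -> P i k.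
Proof.
move=> FF FP; elim: n => [|n ih].
  by apply: filterS (FP 0%N) => k Pk i; rewrite leqn0 => /eqP->.
apply: filterS2 (FP n.+1) ih => k Pk ihk i; rewrite leq_eqVlt.
by move=> /predU1P[->//|]; rewrite ltnS; exact: ihk.
Qed.

Lemma near_forall_mem (T : Type) (I : eqType) (s : seq I) (F : set_system T)
    (P : I -> T -> Prop) :
  Filter F -> (forall i, i \in s -> \forall k \near F, P i k) ->
  \forall k \near F, forall i, i \in s -> P i k.
Proof.
move=> FF; elim: s => [|i s ih] FP; first exact: nearW.
have := ih (fun j js => FP j (@mem_behead _ (i :: s) j js)).
apply: filterS2 (FP i (mem_head _ _)) => k Pk ihk j; rewrite inE.
by move=> /predU1P[->//|]; exact: ihk.
Qed.

(** * Microstates of finite accuracy *)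

Section microstates.
Variables (R : realType) (G : groupType) (e : nat -> G) (d : nat -> nat).
Variable sigma : forall k, G -> 'S_(d k).
Variables (X : compactMetricGroupType R) (a : G -> X -> X).
Hypothesis e_surj : forall g, exists i, e i = g.
Hypothesis a_algebraic : algebraic_action a.
Hypothesis d_gt0 : forall k, (0 < d k)%N.

(** A single [n] bounds the tolerance, the proportion of exceptional indices and the part of the
    enumeration [e] that is tested. Topological microstates thus become a decreasing sequence of
    conditions, to which [diagonal] applies. *)
Definition microstate n k (phi : 'I_(d k) -> X) := forall i, (i <= n)%N ->
  unif R [set j | n.+1%:R^-1 <= mdist (a (e i) (phi j)) (phi (sigma k (e i) j))]
    <= n.+1%:R^-1.

Lemma act1g g : a g 1%g = 1%g.
Proof. by apply: (mulgI (a g 1%g)); rewrite -(act_morph a_algebraic) !mulg1. Qed.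

Lemma actV g x : a g x^-1%g = (a g x)^-1%g.
Proof.
by apply: (mulgI (a g x)); rewrite -(act_morph a_algebraic) !mulgV act1g.
Qed.

Lemma microstate_le m n k (phi : 'I_(d k) -> X) :
  (m <= n)%N -> microstate n phi -> microstate m phi.
Proof.
move=> mn phin i im.
have nm : n.+1%:R^-1 <= m.+1%:R^-1 :> R by rewrite lef_pV2 ?posrE// ler_nat.
apply: le_trans (le_trans (phin i (leq_trans im mn)) nm).
by apply: le_unif => j /=; exact: le_trans.
Qed.

Lemma microstate1 n k : microstate n (fun=> 1%g : X) (k := k).
Proof.
move=> i _; rewrite (_ : mkset _ = set0) ?unif_set0 ?invr_ge0//.
by rewrite -subset0 => j /=; rewrite act1g mdistxx leNgt invr_gt0 ltr0Sn.
Qed.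

Lemma microstate_div n : exists m, forall k (phi psi : 'I_(d k) -> X),
  microstate m phi -> microstate m psi ->
  microstate n (fun j => phi j * (psi j)^-1)%g.
Proof.
have [r r0 rP] := @divg_uniform R X n.+1%:R^-1 ltac:(by rewrite invr_gt0).
(* [l] brings the tolerance below the modulus [r], and [(n.+1).*2] lets two exceptional sets fit
   into [n.+1%:R^-1]. *)
have [l lP] := invS_lt r0; pose m := maxn (maxn n l) (n.+1).*2.
have ml : m.+1%:R^-1 < r by apply: lP; rewrite !leq_max leqnn orbT.
have mn : m.+1%:R^-1 + m.+1%:R^-1 <= n.+1%:R^-1 :> R.
  rewrite -mulr2n -[leLHS]mulr_natr -ler_pdivlMr// -invfM -natrM.
  by rewrite lef_pV2 ?posrE// ler_nat muln2 (@leq_trans m)// leq_maxr.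
exists m => k phi psi phim psim i im.
have im' : (i <= m)%N by rewrite /m !leq_max im.
apply: le_trans mn; apply: le_trans (lerD (phim i im') (psim i im')).
apply: le_trans (unifU _ _ _); apply: le_unif => j /=.
rewrite (act_morph a_algebraic) actV.
have [|phij] := leP _ (mdist (a (e i) (phi j)) _); first by left.
have [|psij] := leP _ (mdist (a (e i) (psi j)) _); first by right.
by rewrite leNgt rP//; exact: lt_trans ml.
Qed.

Lemma microstate_unif_good n k (phi : 'I_(d k) -> X) g (U : set (X * X)) r :
  0 < r -> (forall x y, mdist x y < r -> U (x, y)) ->
  (exists i, [/\ (i <= n)%N, e i = g & n.+1%:R^-1 < r]) ->
  microstate n phi ->
  1 - n.+1%:R^-1 <= unif R [set j | U (a g (phi j), phi (sigma k g j))].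
Proof.
move=> r0 Ur [i [im <- nr]] /(_ i im) H.
apply: (le_trans (y := 1 - unif R _)); first by rewrite lerD2l lerN2; exact: H.
rewrite -unifC//; apply: le_unif => j /= /negP.
by rewrite -ltNge => H1; apply: Ur; exact: lt_trans nr.
Qed.

Lemma topological_microstatesP (phi : forall k, 'I_(d k) -> X) :
  topological_microstates sigma a phi <->
  forall n, \forall k \near \oo, microstate n (phi k).
Proof.
split=> [phiP n|phiP g U nU].
  have H (i : nat) : \forall k \near \oo,
      unif R [set j | n.+1%:R^-1 <=
        mdist (a (e i) (phi k j)) (phi k (sigma k (e i) j))] <= n.+1%:R^-1.
    have := phiP (e i) [set p | mdist p.1 p.2 < n.+1%:R^-1].
    move=> /(_ _)/cvgrPdist_le/(_ n.+1%:R^-1 _)[].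
    - move=> x; have n20 : 0 < n.+1%:R^-1 / 2 :> R by rewrite divr_gt0// invr_gt0.
      exists (ball x (n.+1%:R^-1 / 2), ball x (n.+1%:R^-1 / 2)).
        by split; exact: nbhsx_ballx.
      by move=> [y z] [xy xz] /=; have := ball_splitr xy xz; rewrite ballEmdist.
    - by rewrite invr_gt0.
    move=> K _ KP; exists K => // k /KP /=; apply: le_trans.
    rewrite -unifC//; apply: le_trans (ler_norm _).
    by apply: le_unif => j /=; rewrite leNgt => /negP.
  exact: near_forall_leq.
have [r r0 rU] := diagonal_mdist (@compact_groupT R X) nU.
have [i0 i0g] := e_surj g.
apply/cvgrPdist_le => eps eps0.
have [n nP] := @invS_lt R (Num.min r eps) ltac:(by rewrite lt_min r0).
have /nP := leq_maxl n i0; rewrite lt_min => /andP[mr meps].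
have := phiP (maxn n i0); apply: filterS => k phik.
have := microstate_unif_good (g := g) r0 rU _ phik.
move=> /(_ _)/wrap[|H]; first by exists i0; split => //; exact: leq_maxr.
rewrite ger0_norm ?subr_ge0 ?unif_le1//.
by rewrite lerBlDr -lerBlDl (le_trans _ H)// lerD2l lerN2 ltW.
Qed.

End microstates.

Lemma mdist_continuous (R : realType) (Y Z : metricType R) (f : Y -> Z) :
  (forall e : R, 0 < e -> exists2 d, 0 < d &
    forall x y, mdist x y < d -> mdist (f x) (f y) < e) -> continuous f.
Proof.
move=> fP x A /nbhs_ballP[e /= e0 eA]; have [d d0 dP] := fP e e0.
apply/nbhs_ballP; exists d => // y; rewrite ballEmdist => /dP xy.
by apply: eA; rewrite ballEmdist.
Qed.

(** * Limits of approximate subgroups *)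

Section metric_sets.
Variables (R : realType) (Y : metricType R).

Lemma setdist_lipschitz (K : set Y) x y : K !=set0 ->
  `|setdist x K - setdist y K| <= mdist x y.
Proof.
move=> K0; have xy := setdist_triangle x y K0.
have yx := setdist_triangle y x K0; rewrite metric_sym in yx.
by rewrite ler_norml; apply/andP; split; lra.
Qed.

Lemma lipschitz_continuous (f : Y -> R) :
  (forall x y, `|f x - f y| <= mdist x y) -> continuous f.
Proof.
move=> fP x; apply/cvgrPdist_lt => e e0; near=> y.
rewrite (le_lt_trans (fP _ _))//.
suff : ball x e y by rewrite ballEmdist.
by near: y; exact: nbhsx_ballx.
Unshelve. all: by end_near. Qed.

Lemma continuous_setdist (K : set Y) : K !=set0 ->
  continuous (fun x => setdist x K).
Proof. by move=> K0; apply: lipschitz_continuous => x y; exact: setdist_lipschitz. Qed.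

(** The distance to the complement of [U] serves. Such functions let integrals of continuous
    functions determine a Borel measure. *)
Lemma open_cozero (U : set Y) : open U -> exists f : Y -> R,
  [/\ continuous f, forall x, 0 <= f x & U = [set x | 0 < f x]].
Proof.
move=> oU; have [UC0|UC0] := pselect ((~` U) !=set0).
  exists (fun x => setdist x (~` U)); split.
  - exact: continuous_setdist.
  - by move=> x; exact: setdist_ge0.
  apply/seteqP; split => x /= Ux.
    rewrite lt_neqAle setdist_ge0 andbT eq_sym; apply/eqP => x0.
    exact: (setdist_eq0 UC0 (open_closedC oU) x0).
  apply: contrapT => nUx; have := @setdist_le _ _ x x (~` U) nUx.
  by rewrite mdistxx leNgt Ux.
(* The distance to the empty set is [0], so the whole space needs another function. *)
exists (fun=> 1); split => //; first exact: cst_continuous.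
apply/seteqP; split => x //= _.
by apply: contrapT => nUx; apply: UC0; exists x.
Qed.

End metric_sets.

Section limits_of_subgroups.
Variables (R : realType) (X : compactMetricGroupType R).
Implicit Types (E A B : set X) (H K Y : closedSubgroup X).

(** Hausdorff closeness for arbitrary sets, since finite sets of values are to be compared with
    subgroups. *)
Definition close e A B :=
  (forall x, A x -> exists2 y, B y & mdist x y < e) /\
  (forall y, B y -> exists2 x, A x & mdist y x < e).

Definition approx_subgroup e E := forall x y, E x -> E y ->
  exists2 z, E z & mdist (x * y^-1)%g z < e.

(** [Y] consists of the points that [E t] approaches for [F]-most [t]; quotients pass to this limit.
    Closeness is checked on the balls of a finite net, for each of which the ultrafilter decides
    whether [E t] meets it. *)
Lemma ultra_limit_subgroup (T : Type) (F : set_system T) (E : T -> set X) :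
  UltraFilter F -> (forall t, E t !=set0) ->
  (forall e, 0 < e -> \forall t \near F, approx_subgroup e (E t)) ->
  exists Y, forall e, 0 < e -> \forall t \near F, close e (E t) Y.
Proof.
move=> UF E0 EF.
pose meets x r := [set t | exists2 y, E t y & mdist x y < r].
pose Y := [set x : X | forall r, 0 < r -> F (meets x r)].
have Ycl : closed Y.
  move=> x clYx r r0; have r20 : 0 < r / 2 by rewrite divr_gt0.
  have [y [Yy]] := clYx _ (nbhsx_ballx x (r / 2) r20).
  rewrite ballEmdist => xy.
  apply: filterS (Yy _ r20) => t [z Ez yz]; exists z => //.
  by rewrite (le_lt_trans (metric_triangle x y z))// (splitr r) ltrD.
have Y1 : Y 1%g.
  move=> r r0; apply: filterS (EF r r0) => t Et; have [x Ex] := E0 t.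
  by have := Et x x Ex Ex; rewrite mulgV.
have Ydiv x y : Y x -> Y y -> Y (x * y^-1)%g.
  move=> Yx Yy r r0; have r20 : 0 < r / 2 by rewrite divr_gt0.
  have [s s0 sP] := @divg_uniform R X _ r20.
  apply: filterS3 (Yx s s0) (Yy s s0) (EF _ r20) => t [x' Ex' xx'] [y' Ey' yy'].
  move=> /(_ _ _ Ex' Ey')[z Ez zP]; exists z => //.
  rewrite (le_lt_trans (metric_triangle _ (x' * y'^-1)%g _))// (splitr r) ltrD//.
  exact: sP.
have YV x : Y x -> Y x^-1%g by move=> Yx; have := Ydiv _ _ Y1 Yx; rewrite mul1g.
have hY : closed_subgroup Y.
  split=> // x y Yx /YV Yy.
  by have := Ydiv _ _ Yx Yy; rewrite invgK.
exists (ClosedSubgroup hY) => e e0; have e40 : 0 < e / 4 by rewrite divr_gt0.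
have [s sP] := finite_net (@compact_groupT R X) e40.
have e3 : e / 4 + e / 4 + e / 4 < e by lra.
(* Either [E t] misses the ball for most [t] and there is nothing to show, or points [x_ t] of [E t]
   in the ball have an ultralimit [p], which lies in [Y] and is near the ball. *)
have near1 c : \forall t \near F, forall x, E t x -> mdist c x < e / 4 ->
    exists2 y, Y y & mdist x y < e.
  have [Fc|] := in_ultra_setVsetC (meets c (e / 4)) UF; last first.
    by apply: filterS => t tc x Ex cx; exfalso; apply: tc; exists x.
  pose x_ t := if pselect (meets c (e / 4) t) is left h then
    projT1 (cid2 h) else 1%g.
  have x_P t : meets c (e / 4) t -> E t (x_ t) /\ mdist c (x_ t) < e / 4.
    by rewrite /x_; case: pselect => // h _; case: cid2.
  have [p [_ clp]] := @compact_groupT R X (x_ @ F) _ filterT.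
  have Fp r : 0 < r -> F [set t | mdist p (x_ t) < r].
    move=> r0; have [//|Fn] := in_ultra_setVsetC [set t | mdist p (x_ t) < r] UF.
    have := clp [set x | ~ mdist p x < r] (ball p r).
    move=> /(_ Fn (nbhsx_ballx p r r0))[y []/=].
    by rewrite ballEmdist.
  have Yp : Y p.
    move=> r r0; apply: filterS2 Fc (Fp r r0) => t /x_P[Et _] pt.
    by exists (x_ t).
  have /filter_ex[t [/x_P[_ ct] pt]] : F (meets c (e / 4) `&`
      [set t | mdist p (x_ t) < e / 4]) by exact: filterI Fc (Fp _ e40).
  apply: nearW => t' x _ cx; exists p => //; apply: le_lt_trans e3.
  apply: le_trans (metric_triangle x (x_ t) p) _.
  apply: lerD; last by rewrite metric_sym ltW.
  apply: le_trans (metric_triangle x c (x_ t)) _.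
  by apply: lerD; [rewrite metric_sym ltW|rewrite ltW].
have near2 c : \forall t \near F, forall y, Y y -> mdist c y < e / 4 ->
    exists2 x, E t x & mdist y x < e.
  have [[y [Yy cy]]|nY] := pselect (exists y, Y y /\ mdist c y < e / 4); last first.
    by apply: nearW => t y Yy cy; exfalso; apply: nY; exists y.
  apply: filterS (Yy _ e40) => t [x Ex yx] z Yz cz; exists x => //.
  apply: le_lt_trans e3.
  apply: le_trans (metric_triangle z y x) _.
  apply: lerD; last by rewrite ltW.
  apply: le_trans (metric_triangle z c y) _.
  by apply: lerD; [rewrite metric_sym ltW|rewrite ltW].
have N1 := near_forall_mem (s := s) _ (fun c _ => near1 c).
have N2 := near_forall_mem (s := s) _ (fun c _ => near2 c).
apply: filterS2 (N1 _) (N2 _) => t t1 t2; split=> [x Ex|y Yy].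
  have [c cs] := sP x; rewrite ballEmdist => cx.
  exact: t1 c cs x Ex cx.
have [c cs] := sP y; rewrite ballEmdist => cy.
exact: t2 c cs y Yy cy.
Qed.

(** Counterexamples at the scales [n.+1%:R^-1] would have an ultralimit subgroup, to which some of
    them are close. *)
Lemma approx_subgroup_close e : 0 < e -> exists2 r, 0 < r &
  forall E, E !=set0 -> approx_subgroup r E -> exists Y, close e E Y.
Proof.
move=> e0; apply: contrapT => nr.
have bad n : exists E, [/\ E !=set0, approx_subgroup n.+1%:R^-1 E &
    forall Y, ~ close e E Y].
  apply: contrapT => nE; apply: nr; exists n.+1%:R^-1; first by rewrite invr_gt0.
  move=> E E0 En; apply: contrapT => nY; apply: nE; exists E; split => // Y cY.
  by apply: nY; exists Y.
have [U [UU ooU]] := ultraFilterLemma eventually_filter.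
pose E n := projT1 (cid (bad n)).
have EP n : [/\ E n !=set0, approx_subgroup n.+1%:R^-1 (E n) &
    forall Y, ~ close e (E n) Y] by rewrite /E; case: cid.
have [n|r r0|Y YP] := @ultra_limit_subgroup nat U E UU.
- by have [] := EP n.
- apply: ooU; have [n nP] := invS_lt r0; exists n => // m nm x y Ex Ey.
  have [_ /(_ x y Ex Ey)[z Ez xyz] _] := EP m; exists z => //.
  exact: lt_trans (nP _ nm).
- by have /filter_ex[n nc] := YP e e0; have [_ _ /(_ Y)] := EP n.
Qed.

Lemma close_mdist e H K : close e H K -> mdist H K <= e.
Proof.
move=> [HK KH]; apply: hausdorff_dist_le => x.
  by move=> /HK[y Ky xy]; exact: le_trans (setdist_le x Ky) (ltW xy).
by move=> /KH[y Hy xy]; exact: le_trans (setdist_le x Hy) (ltW xy).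
Qed.

Lemma mdist_close e H K : mdist H K < e -> close e H K.
Proof.
move=> HKe; split=> x Hx; apply: setdist_lt; try exact: sub_neq0.
  exact: le_lt_trans (setdist_hausdorff_dist K Hx) HKe.
rewrite metric_sym in HKe.
exact: le_lt_trans (setdist_hausdorff_dist H Hx) HKe.
Qed.

Lemma setdist_mdist x H K : setdist x H <= setdist x K + mdist H K.
Proof.
apply/ler_addgt0Pr => e e0.
have [|y Ky xy] := @setdist_lt _ _ x K (setdist x K + e / 2) (sub_neq0 K).
  by rewrite ltrDl divr_gt0.
have [|_ /(_ y Ky)[z Hz yz]] := @mdist_close (mdist H K + e / 2) H K.
  by rewrite ltrDl divr_gt0.
apply: le_trans (setdist_le x Hz) _.
by apply: le_trans (metric_triangle x y z) _; lra.
Qed.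

(** Subgroups are approximate subgroups at every scale, so along an ultrafilter they converge to
    their ultralimit. *)
Lemma compact_closedSubgroup : compact [set: closedSubgroup X].
Proof.
rewrite compact_ultra => F UF _.
have [H|r r0|Y YP] := @ultra_limit_subgroup _ F (@sub_set _ _) UF.
- exact: sub_neq0.
- apply: nearW => H x y Hx Hy; exists (x * y^-1)%g; last by rewrite mdistxx.
  by have [_ _ HM HV] := sub_setP H; apply: HM => //; exact: HV.
- exists Y; split => // A /nbhs_ballP[e /= e0 YeA].
  have e20 : 0 < e / 2 by rewrite divr_gt0.
  apply: filterS (YP _ e20) => H /close_mdist HY; apply: YeA.
  by rewrite ballEmdist /= metric_sym (le_lt_trans HY)//; lra.
Qed.

Lemma sub_act_uniform (G : groupType) (a : G -> X -> X)
    (ha : algebraic_action a) g (e : R) : 0 < e -> exists2 d, 0 < d &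
  forall H K, mdist H K < d -> mdist (sub_act ha g H) (sub_act ha g K) < e.
Proof.
move=> e0; have e20 : 0 < e / 2 by rewrite divr_gt0.
have [d d0 dP] := mdist_uniform_continuity (@compact_groupT R X)
  (@act_continuous _ _ _ _ ha g) e20.
exists d => // H K /mdist_close[HK KH].
have : close (e / 2) (sub_act ha g H) (sub_act ha g K).
  split=> _ [x Hx <-].
    by have [y Ky xy] := HK x Hx; exists (a g y); [exists y|exact: dP].
  by have [y Ky xy] := KH x Hx; exists (a g y); [exists y|exact: dP].
by move=> /close_mdist HKe; rewrite (le_lt_trans HKe)//; lra.
Qed.

Lemma continuous_sub_act (G : groupType) (a : G -> X -> X)
  (ha : algebraic_action a) g : continuous (sub_act ha g).
Proof.
apply: mdist_continuous => e /(sub_act_uniform ha g)[d d0 dP].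
by exists d => // H K; exact: dP.
Qed.

End limits_of_subgroups.

(** * Integrals *)

Section empirical_integral.
Variables (R : realType) (T : ptopologicalType) (n : nat) (n_gt0 : (0 < n)%N).
Variable Y : 'I_n -> T.

Lemma empiricalE (A : set (borel T)) :
  empirical R n_gt0 Y A = (unif R (Y @^-1` A))%:E.
Proof. by []. Qed.

Let invn_ge0 : 0 <= n%:R^-1 :> R. Proof. by rewrite invr_ge0. Qed.

(** The terms of [msum] are indexed by all naturals; [insubd] falls back to the index [0] from [n]
    on, where the sum has already stopped. *)
Let m (k : nat) : {measure set (borel T) -> \bar R} :=
  mscale (NngNum invn_ge0) (dirac (Y (insubd (Ordinal n_gt0) k) : borel T)).

Let empirical_msum A : empirical R n_gt0 Y A = msum m n A.
Proof.
rewrite empiricalE unif_sum mulr_sumr -sumEFin /msum; apply: eq_bigr => j _.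
have -> : m j A = (n%:R^-1 * \1_A (Y (insubd (Ordinal n_gt0) j) : borel T))%:E by [].
rewrite indicE.
rewrite (_ : insubd _ _ = j); last first.
  by apply: val_inj; rewrite insubdK//; exact: ltn_ord.
by case: asboolP => Aj; [rewrite mem_set|rewrite memNset].
Qed.

Let ge0_integral_empirical (f : borel T -> R) : measurable_fun setT f ->
  (forall x, 0 <= f x) ->
  (\int[empirical R n_gt0 Y]_x (f x)%:E = (n%:R^-1 * \sum_(j < n) f (Y j))%:E)%E.
Proof.
move=> mf f0; rewrite (eq_measure_integral (msum m n)) => [|A _ _]; last first.
  exact: empirical_msum.
rewrite ge0_integral_measure_sum//; last exact/measurable_EFinP.
rewrite mulr_sumr -sumEFin; apply: eq_bigr => j _.
rewrite ge0_integral_mscale//; [|exact/measurable_EFinP|by move=> x _; rewrite lee_fin].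
rewrite integral_dirac//; last exact/measurable_EFinP.
rewrite diracT mul1e -EFinM (_ : insubd _ _ = j)//.
- by apply: val_inj; rewrite insubdK//; exact: ltn_ord.
- by move=> x _; rewrite lee_fin f0.
Qed.

Lemma integral_empirical (f : T -> R) :
  measurable_fun setT (f : borel T -> R) ->
  \int[empirical R n_gt0 Y]_x f x = n%:R^-1 * \sum_(j < n) f (Y j).
Proof.
move=> mf; rewrite /Rintegral integralE.
have -> : (fun x => (f x)%:E)^\+%E = (fun x : borel T => (f^\+ x)%:E).
  by apply/funext => x; rewrite /= funeposE /funrpos EFin_max.
have -> : (fun x => (f x)%:E)^\-%E = (fun x : borel T => (f^\- x)%:E).
  by apply/funext => x; rewrite /= funenegE /funrneg EFin_max.
rewrite !ge0_integral_empirical ?funrpos_ge0//=.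
- rewrite -mulrBr -sumrB; congr (_ * _); apply: eq_bigr => j _.
  by rewrite -[in RHS](funrposBneg f).
- exact: measurable_funrneg.
- exact: measurable_funrpos.
Qed.

End empirical_integral.

Section continuous_integrals.
Variables (R : realType).

Section measurability.
Variable T : ptopologicalType.

Lemma continuous_measurable (f : T -> R) : continuous f ->
  measurable_fun setT (f : borel T -> R).
Proof.
move=> /continuousP cf; apply: (measurability _ (RGenOpens.measurableE R)).
move=> _ [_ [a [b ->] <-]]; rewrite setTI; apply: sub_sigma_algebra.
exact/cf/interval_open.
Qed.

Lemma compact_bounded (f : T -> R) : compact [set: T] -> continuous f ->
  exists M, forall x, `|f x| <= M.
Proof.
move=> cT cf.
have := continuous_compact (continuous_subspaceT cf) cT.
move=> /compact_bounded[M [_ MP]]; exists (`|M| + 1) => x.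
apply: (MP (`|M| + 1)); last by exists x.
by rewrite ltr_pwDr// ler_norm.
Qed.

Lemma prob_setT (mu : Prob R T) : mu [set: borel T] = 1%E.
Proof. exact: probability_setT. Qed.

Lemma bounded_integrable (mu : Prob R T) (f : borel T -> R) M :
  measurable_fun setT f -> (forall x, `|f x| <= M) ->
  mu.-integrable setT (EFin \o f).
Proof.
move=> mf fM; apply: measurable_bounded_integrable => //.
  by rewrite [X in (X < _)%E](prob_setT mu) ltry.
exists M; split; first exact: num_real.
by move=> N MN x _ /=; rewrite (le_trans (fM x))// ltW.
Qed.

End measurability.

Variable T : ptopologicalType.
Hypothesis cT : compact [set: T].

Lemma continuous_integrable (mu : Prob R T) (f : T -> R) :
  continuous f -> mu.-integrable setT (EFin \o (f : borel T -> R)).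
Proof.
move=> cf; have [M fM] := compact_bounded cT cf.
by apply: (bounded_integrable _ (M := M)) => //; exact: continuous_measurable.
Qed.

Lemma Rintegral_prob_cst (mu : Prob R T) (c : R) : \int[mu]_x c = c.
Proof.
rewrite Rintegral_cst//.
by rewrite [X in fine X](prob_setT mu) mulr1.
Qed.

Lemma le_integral (mu : Prob R T) (f g : T -> R) :
  continuous f -> continuous g -> (forall x, f x <= g x) ->
  \int[mu]_x f x <= \int[mu]_x g x.
Proof.
move=> cf cg fg; apply: le_Rintegral => //; exact: continuous_integrable.
Qed.

Lemma dist_integral (mu : Prob R T) (f g : T -> R) e :
  continuous f -> continuous g -> (forall x, `|f x - g x| <= e) ->
  `|\int[mu]_x f x - \int[mu]_x g x| <= e.
Proof.
move=> cf cg fg.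
have ce (h : T -> R) (c : R) : continuous h -> continuous (fun x => h x + c).
  by move=> ch x; apply: cvgD; [exact: ch|exact: cvg_cst].
have eqD (h : T -> R) (c : R) : continuous h ->
    \int[mu]_x (h x + c) = \int[mu]_x h x + c.
  move=> ch; rewrite RintegralD// ?Rintegral_prob_cst//.
    exact: continuous_integrable.
  by apply: continuous_integrable; exact: cst_continuous.
have fge x : f x <= g x + e.
  by rewrite -lerBlDl (le_trans (ler_norm _)).
have gfe x : g x <= f x + e.
  by rewrite -lerBlDl (le_trans (ler_norm _))// distrC.
have := le_integral mu cf (ce _ e cg) fge; have := le_integral mu cg (ce _ e cf) gfe.
rewrite !eqD// => H1 H2.
by rewrite ler_norml; apply/andP; split; lra.
Qed.

(** Two initial topologies are unfolded: that of [integrals], and that of the projections of the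
    product it maps to. *)
Lemma prob_cvgP (I : Type) (F : set_system I) (u : I -> Prob R T) (mu : Prob R T) :
  Filter F ->
  u @ F --> mu <->
  forall f : T -> R, continuous f -> \int[u k]_x f x @[k --> F] --> \int[mu]_x f x.
Proof.
move=> FF; split=> [umu f cf|umu].
  have umu' : integrals (u k) @[k --> F] --> integrals mu.
    apply: (@cvg_comp _ _ _ u (@integrals R T) F (nbhs mu) _ umu).
    exact: initial_continuous.
  apply: (@cvg_comp _ _ _ (fun k => integrals (u k)) (fun h => h (mkcts cf)) F
    (nbhs (integrals mu)) _ umu').
  exact: (@proj_continuous (continuousType T R) (fun=> R) (mkcts cf) (integrals mu)).
have umu' : integrals (u k) @[k --> F] --> integrals mu.
  apply/cvg_sup => f.
  move=> A [_ [[B oB <-] Bf sBA]].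
  have H : F (fun k => B (\int[u k]_x f x)).
    exact: umu f (@cts_fun _ _ f) B (open_nbhs_nbhs (conj oB Bf)).
  change (F (fun k => A (integrals (u k)))).
  by apply: filterS H => k Bk; apply: sBA.
move=> A [_ [[B oB <-] Bmu sBA]].
have H : F (fun k => B (integrals (u k))).
  exact: umu' B (open_nbhs_nbhs (conj oB Bmu)).
change (F (fun k => A (u k))).
by apply: filterS H => k Bk; apply: sBA.
Qed.

Lemma integral_marginal n (j : 'I_n) (mu : Prob R {ptws 'I_n -> T})
    (f : T -> R) : continuous f ->
  \int[marginal j mu]_x f x = \int[mu]_phi f (phi j).
Proof.
move=> cf; have [M fM] := compact_bounded cT cf.
have mf := continuous_measurable cf.
have cj : continuous (fun phi : {ptws 'I_n -> T} => f (phi j)).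
  move=> phi; apply: (@continuous_comp _ _ _ (fun phi : {ptws 'I_n -> T} => phi j) f).
    exact: (@proj_continuous 'I_n (fun=> T) j phi).
  exact: cf.
rewrite /Rintegral; congr fine; rewrite /marginal integral_distribution//.
  exact/measurable_EFinP.
apply: (bounded_integrable (T := {ptws 'I_n -> T}) mu
  (f := fun phi : borel {ptws 'I_n -> T} => f (phi j)) (M := M)) => //.
exact: (continuous_measurable (T := {ptws 'I_n -> T})).
Qed.

End continuous_integrals.

Section haar_integral.
Variables (R : realType) (X : compactMetricGroupType R) (m : Prob R X).
Hypothesis mhaar : haar m.

Lemma integral_mulg (x : X) (f : X -> R) : continuous f ->
  \int[m]_y f (x * y)%g = \int[m]_y f y.
Proof.
move=> cf.
have cx : continuous (fun y : X => x * y)%g.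
  apply: (@mdist_continuous R X X) => e /(@mulg_uniform R X)[d d0 dP].
  by exists d => // y z; exact: dP.
have mx : measurable_fun setT ((fun y : X => x * y)%g : borel X -> borel X).
  exact: continuous_borel.
rewrite /Rintegral; congr fine.
have mf : measurable_fun setT (EFin \o (f : borel X -> R)).
  by apply/measurable_EFinP; exact: (continuous_measurable cf).
have cfx : continuous (fun y => f (x * y)%g).
  by move=> y; apply: continuous_comp; [exact: cx|exact: cf].
have intf : m.-integrable setT (EFin \o (fun y : borel X => f (x * y)%g)).
  exact: continuous_integrable (@compact_groupT R X) m _ cfx.
have := integral_pushforward mx mf intf measurableT.
rewrite preimage_setT => <-.
apply: eq_measure_integral => A mA _.
exact: mhaar.
Qed.

End haar_integral.

Section equality_of_measures.
Variables (R : realType) (T : ptopologicalType).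
Hypothesis cT : compact [set: T].
Hypothesis cozero : forall U : set T, open U -> exists f : T -> R,
  [/\ continuous f, forall x, 0 <= f x & U = [set x | 0 < f x]].
Implicit Types mu nu : Prob R T.

Lemma open_borel (U : set T) : open U -> measurable (U : set (borel T)).
Proof. exact: sub_sigma_algebra. Qed.

Lemma EFin_Rintegral mu (f : T -> R) : continuous f ->
  (\int[mu]_x f x)%:E = (\int[mu]_x (f x)%:E)%E.
Proof.
move=> cf; rewrite /Rintegral fineK//; apply: integrable_fin_num => //.
exact: (continuous_integrable cT mu cf).
Qed.

(** With [U] the set where [f > 0], the sets [F n] where [f >= n.+1%:R^-1] exhaust [U], and the
    minimum of [1] and [n.+1%:R * f] lies between the indicators of [F n] and [U]. *)
Lemma le_measure_open mu nu :
  (forall f : T -> R, continuous f -> \int[mu]_x f x = \int[nu]_x f x) ->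
  forall U : set (borel T), open (U : set T) -> (mu U <= nu U)%E.
Proof.
move=> mn U oU; have [f [cf f0 Uf]] := cozero oU.
pose F n : set (borel T) := [set x | n.+1%:R^-1 <= f x].
have mF n : measurable (F n).
  have -> : F n = f @^-1` `[n.+1%:R^-1, +oo[%classic.
    by apply/seteqP; split => x /=; rewrite in_itv/= andbT.
  rewrite -[X in measurable X]setTI.
  by apply: (continuous_measurable cf) => //; exact: measurable_itv.
have UF : U = \bigcup_n F n.
  rewrite Uf; apply/seteqP; split => x /=.
    by move=> /invS_lt[n nP]; exists n => //; exact/ltW/nP.
  by move=> [n _]; apply: lt_le_trans; rewrite invr_gt0.
have mU : measurable U by exact: open_borel.
have ndF : nondecreasing_seq F.
  move=> m n mn'; apply/subsetPset => x /=; apply: le_trans.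
  by rewrite lef_pV2 ?posrE// ler_nat ltnS.
have := @nondecreasing_cvg_mu _ _ _ mu F mF; rewrite -UF => /(_ mU ndF).
apply: cvge_le; apply: nearW => n /=.
pose g (x : T) : R := Num.min 1 (n.+1%:R * f x).
have cg : continuous g.
  move=> x; apply: (@continuous_min _ _ (fun=> 1) (fun x => n.+1%:R * f x)).
    exact: cvg_cst.
  by apply: cvgM; [exact: cvg_cst|exact: cf].
have g0 x : 0 <= g x by rewrite le_min ler01 mulr_ge0.
have mg : measurable_fun setT (EFin \o (g : borel T -> R)).
  by apply/measurable_EFinP; exact: (continuous_measurable cg).
apply: (@le_trans _ _ (\int[mu]_x (g x)%:E)%E).
  have := integral_indic mu measurableT (mF n); rewrite setIT => <-.
  apply: ge0_le_integral => //.
  - exact/measurable_EFinP/measurable_indic.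
  - move=> x _; rewrite lee_fin indicE; case: (boolP (x \in F n)) => [|//].
    rewrite inE /F/= => xF; rewrite le_min lexx/=.
    by rewrite -ler_pdivrMl// mulr1.
rewrite -EFin_Rintegral// mn// EFin_Rintegral//.
have := integral_indic nu measurableT mU; rewrite setIT => <-.
apply: ge0_le_integral => //.
- by move=> x _; rewrite lee_fin g0.
- exact/measurable_EFinP/measurable_indic.
- move=> x _; rewrite lee_fin indicE; case: (boolP (x \in U)) => [_|].
    by rewrite ge_min lexx.
  rewrite notin_setE Uf/= => /negP; rewrite -leNgt => fx0.
  rewrite /g; have -> : f x = 0 by apply/eqP; rewrite eq_le fx0 f0.
  by rewrite mulr0 ge_min lexx orbT.
Qed.

Lemma same_measure_integrals mu nu :
  (forall f : T -> R, continuous f -> \int[mu]_x f x = \int[nu]_x f x) ->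
  same_measure mu nu.
Proof.
move=> mn A mA.
apply: (@measure_unique _ R (borel T) (@open T) (fun=> setT) _ _ _ _ mu nu) => //.
- by move=> B C; exact: openI.
- by move=> _; exact: openT.
- by rewrite bigcup_const.
- move=> U oU; apply/eqP; rewrite eq_le !le_measure_open//.
  by move=> f cf; rewrite mn.
- by move=> _; rewrite [X in (X < _)%E](prob_setT mu) ltry.
Qed.

Lemma same_measure_integral mu nu (f : T -> R) : same_measure mu nu ->
  \int[mu]_x f x = \int[nu]_x f x.
Proof.
move=> mn; rewrite /Rintegral; congr fine; apply: eq_measure_integral => A mA _.
exact: mn.
Qed.

End equality_of_measures.

(** * Limits of empirical measures *)

Section cantor_cylinders.

Definition cylinder (w : seq bool) : set cantor_space :=
  [set x | mkseq x (size w) = w].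

Definition pad (w : seq bool) : cantor_space := fun i => nth false w i.

Lemma cylinder_pad w : cylinder w (pad w).
Proof. by rewrite /cylinder/=; apply: mkseq_nth. Qed.

Lemma cylinder_nbhs (x : cantor_space) (A : set cantor_space) :
  nbhs x A -> exists n, cylinder (mkseq x n) `<=` A.
Proof.
move=> nA; apply: contrapT => nex.
have bad n : exists y : cantor_space, mkseq y n = mkseq x n /\ ~ A y.
  apply: contrapT => ny; apply: nex; exists n => y; rewrite /cylinder/= size_mkseq.
  by move=> yx; apply: contrapT => Ay; apply: ny; exists y.
pose y n := projT1 (cid (bad n)).
have yP n : mkseq (y n) n = mkseq x n /\ ~ A (y n) by rewrite /y; case: cid.
have yx : y @ \oo --> x.
  apply/cvg_sup => i B [_ [[C oC <-] Cx CB]].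
  change (\forall n \near \oo, B (y n)).
  exists i.+1 => // n /= ni; apply: CB.
  rewrite /preimage/=.
  have /(congr1 (fun s => nth false s i)) := (yP n).1.
  by rewrite !nth_mkseq// => ->.
have [n _ /(_ n (leqnn n))] := yx A nA.
exact: (yP n).2.
Qed.

Lemma cylinder_open w : open (cylinder w).
Proof.
elim/last_ind: w => [|w b ih].
  have -> : cylinder [::] = setT by apply/seteqP; split.
  exact: openT.
have -> : cylinder (rcons w b) =
    cylinder w `&` (fun x : cantor_space => x (size w)) @^-1` [set b].
  apply/seteqP; split => x; rewrite /cylinder/= size_rcons mkseqS.
    by move=> /rcons_inj[].
  by move=> [-> ->].
apply: openI => //; apply: open_comp; last exact: discrete_open.
by move=> x _; exact: (@proj_continuous nat (fun=> bool) (size w)).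
Qed.

Lemma locally_constant_approx (R : realType) (g : cantor_space -> R) (e : R) :
  continuous g -> 0 < e -> exists n, forall x y : cantor_space,
    mkseq x n = mkseq y n -> `|g x - g y| < e.
Proof.
move=> cg e0; have /compact_near_coveringP cC := cantor_space_compact.
have [] := cC nat \oo (fun n (x : cantor_space) => forall y : cantor_space,
    mkseq x n = mkseq y n -> `|g x - g y| < e) _.
  move=> x _.
  have e20 : 0 < e / 2 by rewrite divr_gt0.
  have [n nP] := cylinder_nbhs (cg x _ (nbhsx_ballx (g x) (e / 2) e20)).
  exists (cylinder (mkseq x n), [set m | (n <= m)%N]).
    split; last by exists n.
    by apply: open_nbhs_nbhs; split; [exact: cylinder_open|rewrite /cylinder/= size_mkseq].
  move=> [y m]/= [yx nm] z yz.
  apply: (@ball_splitr _ _ (g x)).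
    exact: nP.
  apply: nP; rewrite /cylinder/= size_mkseq in yx *; rewrite -yx.
  have /(congr1 (take n)) := yz.
  by rewrite /mkseq -!map_take take_iota (minn_idPl nm) => ->.
by move=> N _ NP; exists N => x y; exact: (NP N (leqnn N) x).
Qed.

End cantor_cylinders.

Section integral_sum.
Context d (T : measurableType d) (R : realType) (mu : {measure set T -> \bar R}).

Lemma Rintegral_sum I (s : seq I) (F : I -> T -> R) :
  (forall i, mu.-integrable setT (EFin \o F i)) ->
  \int[mu]_x (\sum_(i <- s) F i x) = \sum_(i <- s) \int[mu]_x F i x.
Proof.
move=> Fi; elim: s => [|i s ih].
  rewrite big_nil; under eq_Rintegral do rewrite big_nil.
  by rewrite Rintegral_cst// mul0r.
rewrite big_cons -ih; under eq_Rintegral do rewrite big_cons.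
rewrite RintegralD//.
rewrite (_ : _ \o _ = fun x => (\sum_(i <- s) (F i x)%:E)%E); last first.
  by apply/funext => x; rewrite /= sumEFin.
by apply: integrable_sum => // j _; exact: Fi.
Qed.

End integral_sum.

Section convergence_on_cylinders.
Variable R : realType.
Implicit Types mu : Prob R cantor_space.

Let wts mu w := fine (mu (cylinder w)).

(** The sum is the integral of the step function [s], which samples [g] at one point of each
    cylinder of length [n]. *)
Lemma integral_cylinders mu (g : cantor_space -> R) n (e : R) :
  continuous g ->
  (forall x y : cantor_space, mkseq x n = mkseq y n -> `|g x - g y| < e) ->
  `|\int[mu]_x g x - \sum_(w : n.-tuple bool) wts mu w * g (pad w)| <= e.
Proof.
move=> cg gn.
have mcyl w : measurable (cylinder w : set (borel cantor_space)).
  by apply: open_borel; exact: cylinder_open.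
pose s (x : cantor_space) := g (pad (mkseq x n)).
have sE x : s x = \sum_(w : n.-tuple bool) g (pad w) * \1_(cylinder w) x.
  rewrite (bigD1 (mktuple (fun i : 'I_n => x i)))//= big1 ?addr0; last first.
    move=> w wx; rewrite indicE memNset ?mulr0// /cylinder/= size_tuple => xw.
    move/eqP : wx; apply; apply: val_inj => /=.
    by rewrite -xw /mkseq -val_enum_ord -map_comp.
  have -> : map (fun i : 'I_n => x i) (enum 'I_n) = mkseq x n.
    by rewrite /mkseq -val_enum_ord -map_comp.
  by rewrite indicE mem_set ?mulr1// /cylinder/= size_mkseq.
have ind w : mu.-integrable setT
    (EFin \o (fun x : borel cantor_space => g (pad w) * \1_(cylinder w) x)).
  apply: (bounded_integrable _ (M := `|g (pad w)|)).
    apply: measurable_funM => //; exact: measurable_indic.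
  move=> x; rewrite normrM ler_piMr// indicE.
  by case: (_ \in _); rewrite ?normr1 ?normr0.
have -> : \sum_(w : n.-tuple bool) wts mu w * g (pad w) = \int[mu]_x s x.
  under [RHS]eq_Rintegral do rewrite sE.
  rewrite Rintegral_sum//; apply: eq_bigr => w _.
  rewrite RintegralZl//.
    rewrite mulrC; congr (_ * _).
    by rewrite /Rintegral integral_indic// setIT.
  apply: (bounded_integrable _ (M := 1)); first exact: measurable_indic.
  move=> x; rewrite indicE; by case: (_ \in _); rewrite ?normr1 ?normr0.
have cs : continuous s.
  move=> x; rewrite /continuous_at; apply: cvg_near_cst.
  have : cylinder (mkseq x n) x by rewrite /cylinder/= size_mkseq.
  move=> /(conj (cylinder_open _))/open_nbhs_nbhs; apply: filterS => y.
  by rewrite /cylinder/= size_mkseq /s => ->.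
apply: dist_integral => //; first exact: cantor_space_compact.
move=> x; apply/ltW/gn.
by have := cylinder_pad (mkseq x n); rewrite /cylinder/= size_mkseq.
Qed.

Lemma cvg_cylinders (mu_ : nat -> Prob R cantor_space) mu :
  (forall w, wts (mu_ l) w @[l --> \oo] --> wts mu w) -> mu_ @ \oo --> mu.
Proof.
move=> muw; apply/prob_cvgP => g cg.
apply/cvgrPdist_le => e e0; have e30 : 0 < e / 3 by rewrite divr_gt0.
have [n nP] := locally_constant_approx cg e30.
have sw : \sum_(w : n.-tuple bool) wts (mu_ l) w * g (pad w) @[l --> \oo] -->
    \sum_(w : n.-tuple bool) wts mu w * g (pad w).
  by apply: cvg_big => [|w _]; [exact: add_continuous|apply: cvgMl; exact: muw].
move/cvgrPdist_le : sw => /(_ _ e30); apply: filterS => l sl.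
have H1 := integral_cylinders mu cg nP.
have H2 := integral_cylinders (mu_ l) cg nP.
set A := \int[mu]_x g x in H1 *; set B := \int[mu_ l]_x g x in H2 *.
set a := \sum_(_ | _) _ in sl H1; set b := \sum_(_ | _) _ in sl H2.
move: H1 H2 sl; rewrite !ler_norml => /andP[? ?] /andP[? ?] /andP[? ?].
by apply/andP; split; lra.
Qed.

End convergence_on_cylinders.

(** * A measure on the Cantor space with prescribed cylinder weights *)

Section measure_with_given_cylinders.
Variables (R : realType) (q : seq bool -> R).
Hypothesis q_nil : q [::] = 1.
Hypothesis q_ge0 : forall w, 0 <= q w.
Hypothesis q_rcons : forall w, q w = q (rcons w false) + q (rcons w true).

(* The first [n] bits [w] of the point of the Cantor space coded by [t], and the
   left end of the interval, of length [q w], of all the [t] in [0, 1[ whose code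
   starts with [w]. *)
Fixpoint code (t : R) n : seq bool * R :=
  if n is m.+1 then
    let: (w, l) := code t m in
    if t < l + q (rcons w false) then (rcons w false, l)
    else (rcons w true, l + q (rcons w false))
  else ([::], 0).

Definition decode (t : R) : cantor_space := fun n =>
  ~~ (t < (code t n).2 + q (rcons (code t n).1 false)).

Lemma code_decode t n : (code t n).1 = mkseq (decode t) n.
Proof.
elim: n => // n ih; rewrite mkseqS -ih /decode/=.
by case: (code t n) => w l /=; case: ifP.
Qed.

(** Appending a bit cuts the interval of [w] at [l + q (rcons w false)]. Reals outside [[0, 1[] have
    codes too, so measurability is carried along by intersecting half-lines rather than read off the
    intervals. *)
Lemma decode_cylinder w : exists l, [/\ 0 <= l, l + q w <= 1,
  (forall t, cylinder w (decode t) -> (code t (size w)).2 = l),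
  measurable [set t | cylinder w (decode t)] &
  forall t, 0 <= t < 1 -> (cylinder w (decode t) <-> l <= t < l + q w)].
Proof.
elim/last_ind: w => [|w b [l [l0 lq lE mw wE]]].
  exists 0; rewrite add0r q_nil; split => //.
  by rewrite (_ : mkset _ = setT)//; apply/seteqP; split.
have q0 := q_ge0 (rcons w false); have q1 := q_ge0 (rcons w true).
have qE := q_rcons w.
have rE t : cylinder (rcons w b) (decode t) <->
    cylinder w (decode t) /\ b = ~~ (t < l + q (rcons w false)).
  rewrite /cylinder/= size_rcons mkseqS; split.
    move=> /rcons_inj[wt bt]; split => //.
    by rewrite -bt /decode code_decode wt lE.
  by move=> [wt ->]; rewrite wt /decode code_decode wt lE.
exists (if b then l + q (rcons w false) else l); split.
- by case: b {rE} => //; rewrite addr_ge0.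
- by case: b {rE}; lra.
- move=> t /rE[wt ->]; rewrite size_rcons/=.
  have := lE t wt; have := code_decode t (size w).
  case: (code t (size w)) => w' l'/= w'E ->; rewrite {}w'E wt.
  by case: ifP.
- have -> : [set t | cylinder (rcons w b) (decode t)] =
      [set t | cylinder w (decode t)] `&`
      (if b then `[l + q (rcons w false), +oo[%classic
       else `]-oo, l + q (rcons w false)[%classic).
    apply/seteqP; split => t /=; rewrite rE.
      move=> [wt bE]; split => //; rewrite bE; case: ifP => /=; rewrite in_itv/=.
        by rewrite -leNgt => ->.
      by move=> /negbFE.
    move=> [wt]; case: (b) => /=; rewrite in_itv/= ?andbT.
      by rewrite leNgt => ->.
    by move=> ->.
  by apply: measurableI => //; case: (b); exact: measurable_itv.
- move=> t t01; rewrite rE wE//; case: (b); split.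
  + by move=> [/andP[? ?] /esym]; rewrite -leNgt => ?; apply/andP; split; lra.
  + move=> /andP[? ?]; split; first by apply/andP; split; lra.
    by apply/esym; rewrite -leNgt.
  + by move=> [/andP[? ?] /esym/negbFE ?]; apply/andP; split; lra.
  + move=> /andP[? ?]; split; first by apply/andP; split; lra.
    by apply/esym/negbTE; rewrite negbK.
Qed.

(** An open set is the union of the cylinders inside it, and there are only countably many
    cylinders. *)
Lemma measurable_decode :
  measurable_fun setT (decode : R -> borel cantor_space).
Proof.
apply: (@measurability _ _ R (borel cantor_space) setT _ (@open cantor_space)).
  by [].
move=> _ [U oU <-]; rewrite setTI.
have -> : decode @^-1` U = \bigcup_(w in [set w | cylinder w `<=` U])
    [set t | cylinder w (decode t)].
  apply/seteqP; split => t /=.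
    move=> Ut; have [n nU] := cylinder_nbhs (open_nbhs_nbhs (conj oU Ut)).
    by exists (mkseq (decode t) n) => //=; rewrite /cylinder/= size_mkseq.
  by move=> [w wU]; exact: wU.
rewrite bigcup_mkcond; apply: countable_bigcupT_measurable => [|w].
  exact: countableP.
case: ifP => _; last exact: measurable0.
by have [l []] := decode_cylinder w.
Qed.

Definition decode_rv : measurableTypeR R -> borel cantor_space := decode.

HB.instance Definition _ :=
  isMeasurableFun.Build _ _ _ _ decode_rv measurable_decode.

Let m01 : measurable (`[0, 1[%classic : set R).
Proof. exact: measurable_itv. Qed.

Definition unit_lebesgue := mrestr (@lebesgue_measure R) m01.

HB.instance Definition _ := Measure.on unit_lebesgue.

Let unit_lebesgueT : unit_lebesgue setT = 1%E.
Proof.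
rewrite /unit_lebesgue /mrestr/= setTI lebesgue_measure_itv/= lte_fin ltr01.
by rewrite sube0.
Qed.

HB.instance Definition _ :=
  Measure_isProbability.Build _ _ _ unit_lebesgue unit_lebesgueT.

Definition cylinder_measure : Prob R cantor_space :=
  distribution unit_lebesgue decode_rv.

Lemma cylinder_measureE w : cylinder_measure (cylinder w) = (q w)%:E.
Proof.
have [l [l0 l1 _ _ wE]] := decode_cylinder w.
have q0 := q_ge0 w.
change (lebesgue_measure ([set t | cylinder w (decode t)] `&` `[0, 1[) = (q w)%:E).
have -> : [set t | cylinder w (decode t)] `&` `[0, 1[%classic =
    `[l, l + q w[%classic.
  apply/seteqP; split => t /=; rewrite !in_itv/=.
    by move=> [wt t01]; rewrite -wE.
  move=> /[dup] lt /andP[lt1 lt2].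
  have t01 : 0 <= t < 1 by apply/andP; split; lra.
  by split => //; apply/wE.
rewrite lebesgue_measure_itv/= lte_fin; case: ifPn => [_|].
  by rewrite -EFinB addrC addKr.
rewrite -leNgt gerDl => q0'; congr _%:E.
by apply/eqP; rewrite eq_le q0 q0'.
Qed.

End measure_with_given_cylinders.

Lemma image_probability (R : realType) (S T : ptopologicalType) (f : S -> T) :
  continuous f -> compact [set: T] -> forall mu : Prob R S,
  exists eta : Prob R T, (forall A : set (borel T), eta A = mu (f @^-1` A)) /\
    forall g : T -> R, continuous g -> \int[eta]_x g x = \int[mu]_x g (f x).
Proof.
move=> cf cT mu.
have mf := continuous_borel cf.
pose F : {mfun borel S >-> borel T} := mfun_Sub (mem_set mf).
exists (distribution mu F); split => [//|g cg]; have [M gM] := compact_bounded cT cg.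
have cgf : continuous (g \o f).
  by move=> x; apply: continuous_comp; [exact: cf|exact: cg].
rewrite /Rintegral integral_distribution//.
  by apply/measurable_EFinP; exact: continuous_measurable.
apply: (bounded_integrable mu (f := g \o f) (M := M)).
  exact: continuous_measurable.
by move=> x; exact: gM.
Qed.

Section sequential_compactness.
Variable R : realType.

(** Tychonoff gives a cluster point [q]. Asking at stage [n] only for the coordinates with code at
    most [n], up to [n.+1%:R^-1], is a neighbourhood of [q], and a subsequence meets all these
    stages. *)
Lemma sequential_cluster (I : countType) (p : nat -> I -> R) :
  (forall l i, 0 <= p l i <= 1) ->
  exists (s : nat -> nat) (q : I -> R),
    {homo s : l m / (l < m)%N} /\ forall i, p (s l) i @[l --> \oo] --> q i.
Proof.
move=> p01.
have cK : compact [set f : {ptws I -> R} | forall i, f i \in `[0, 1]].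
  apply: (@tychonoff I (fun=> R) (fun=> [set` `[0, 1]])) => i.
  exact: segment_compact.
have [|q [_ clq]] := cK (p @ \oo) _.
  by exists 0%N => // l _ i; rewrite in_itv/= p01.
have nearq n : nbhs (q : {ptws I -> R}) [set f : {ptws I -> R} |
    forall j, (j <= n)%N -> forall i, unpickle j = Some i -> `|q i - f i| < n.+1%:R^-1].
  apply: (@near_forall_leq _ (nbhs (q : {ptws I -> R})) (fun j (f : {ptws I -> R}) =>
    forall i, unpickle j = Some i -> `|q i - f i| < n.+1%:R^-1)) => j.
  case: (unpickle j) => [i|]; last exact: nearW.
  have n0 : 0 < n.+1%:R^-1 :> R by rewrite invr_gt0.
  have qi : nbhs (q : {ptws I -> R})
      [set f : {ptws I -> R} | ball (q i) n.+1%:R^-1 (f i)].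
    exact: (@proj_continuous I (fun=> R) i q _ (nbhsx_ballx (q i) _ n0)).
  by apply: (filterS _ qi) => f qf k [<-].
have [|s [smono sP]] := @frequently_subsequence (fun n k =>
    forall j, (j <= n)%N -> forall i, unpickle j = Some i -> `|q i - p k i| < n.+1%:R^-1).
  move=> n N.
  have [|f [[k Nk <-] fP]] := clq [set p k | k in [set k | (N <= k)%N]] _ _ (nearq n).
    by exists N => // k Nk; exists k.
  by exists k.
exists s, q; split => // i; apply/cvgrPdist_lt => e e0.
have [n nP] := invS_lt e0.
exists (maxn n (pickle i)) => // l /=; rewrite geq_max => /andP[nl il].
apply: lt_trans (nP l nl); apply: (sP l _ il).
exact: pickleK.
Qed.

(* The points are lifted along a continuous surjection from the Cantor space,
   where weak* convergence is convergence of the measures of all cylinders. *)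
Lemma empirical_subsequence (T : pseudoPMetricType R) (d : nat -> nat)
    (d_gt0 : forall l, (0 < d l)%N) (Y : forall l, 'I_(d l) -> T) :
  compact [set: T] -> hausdorff_space T ->
  exists (s : nat -> nat) (eta : Prob R T), {homo s : l m / (l < m)%N} /\
    empirical R (d_gt0 (s l)) (Y (s l)) @[l --> \oo] --> eta.
Proof.
move=> cT hT; have [f cf] := cantor_surj cT hT.
pose c l (j : 'I_(d l)) : cantor_space := projT1 (cid2 (@surj _ _ setT setT f (Y l j) I)).
have cP l j : f (c l j) = Y l j by rewrite /c; case: cid2.
have [|s [q [smono sq]]] := @sequential_cluster (seq bool)
  (fun l w => unif R [set j | cylinder w (c l j)]).
  by move=> l w; rewrite unif_ge0 unif_le1.
(* The limits of the frequencies inherit the consistency that makes them the cylinder weights of a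
   measure. *)
have q_nil : q [::] = 1.
  apply/esym/(cvg_unique (@Rhausdorff R) _ (sq [::])); apply: cvg_near_cst; apply: nearW => l.
  by rewrite (_ : mkset _ = setT) ?unif_setT//; apply/seteqP; split.
have q_ge0 w : 0 <= q w.
  by apply: (cvgr_to_ge (sq w)); apply: nearW => l; exact: unif_ge0.
have q_rcons w : q w = q (rcons w false) + q (rcons w true).
  apply: (cvg_unique (@Rhausdorff R) (sq w)).
  have sD : unif R [set j | cylinder (rcons w false) (c (s l) j)] +
      unif R [set j | cylinder (rcons w true) (c (s l) j)] @[l --> \oo] -->
      q (rcons w false) + q (rcons w true) by apply: cvgD; exact: sq.
  apply: cvg_trans sD; apply: near_eq_cvg; apply: nearW => l /=.
  rewrite !unif_sum -mulrDr -big_split/=; congr (_ * _); apply: eq_bigr => j _.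
  rewrite /cylinder/= !size_rcons mkseqS -natrD; congr (_%:R).
  case: (asboolP (_ = w)) => [->|nw].
    have rE b b' : `[< rcons w b = rcons w b' >] = (b == b').
      by apply/asboolP/eqP => [/rcons_inj[]|->].
    by rewrite !rE; case: (c (s l) j (size w)).
  by do 2 case: asboolP => [/rcons_inj[]//|_].
pose nu := cylinder_measure q_nil q_ge0 q_rcons.
have [eta [_ etaE]] := @image_probability R cantor_space T f cf cT nu.
exists s, eta; split => //; apply/prob_cvgP => g cg.
have : empirical R (d_gt0 (s l)) (c (s l)) @[l --> \oo] --> nu.
  apply: cvg_cylinders => w; rewrite cylinder_measureE.
  exact: sq w.
move=> /prob_cvgP => /(_ (g \o f)).
rewrite etaE//.
have cgf : continuous (g \o f) by move=> x; apply: continuous_comp; [exact: cf|exact: cg].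
move=> /(_ cgf); apply: cvg_trans; apply: near_eq_cvg; apply: nearW => l /=.
rewrite !integral_empirical; [|exact: continuous_measurable..].
by congr (_ * _); apply: eq_bigr => j _; rewrite /= cP.
Qed.

End sequential_compactness.

(** * Words in a dense list approximate the Haar measure *)

Section words.
Variables (T : Type) (op : T -> T -> T) (u : T).

Fixpoint words (E : seq T) m : seq T :=
  if m is m'.+1 then [seq op w x | w <- words E m', x <- E] else [:: u].

Lemma size_words E m : size (words E m) = (size E ^ m)%N.
Proof. by elim: m => //= m ih; rewrite size_allpairs ih expnSr. Qed.

End words.

(** Meant for evaluation at an index: the values of words in microstates are the words in their
    values. *)
Lemma map_words (S T : Type) (opS : S -> S -> S) (opT : T -> T -> T) u v
    (h : S -> T) (E : seq S) m :
  h u = v -> {morph h : x y / opS x y >-> opT x y} ->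
  map h (words opS u E m) = words opT v (map h E) m.
Proof.
move=> huv hM; elim: m => /= [|m ih]; first by rewrite huv.
rewrite map_allpairs -ih [RHS]allpairs_mapl allpairs_mapr.
by apply: eq_allpairs => x y; rewrite hM.
Qed.

Section doeblin.
Variables (R : realType) (X : compactMetricGroupType R) (m : Prob R X).
Hypothesis mhaar : haar m.
Implicit Types (E : seq X) (f : X -> R).

Let mean (s : seq X) f := (size s)%:R^-1 * \sum_(x <- s) f x.

Let W E n := words (fun x y : X => x * y)%g 1%g E n.

Let fm E f n (x : X) := mean (W E n) (fun w => f (w * x)%g).

(** The letter split off is the one next to [x], so that averaging over it acts on the argument of
    [fm E f n]. *)
Let fmS E f n x : fm E f n.+1 x = mean E (fun y => fm E f n (y * x)%g).
Proof.
rewrite /fm /mean size_words expnS natrM invfM -mulrA; congr (_ * _).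
rewrite /W/= big_allpairs_dep/= exchange_big/= mulr_sumr; apply: eq_bigr => y _.
rewrite size_words; congr (_ * _); apply: eq_bigr => w _.
by rewrite mulgA.
Qed.

Let continuous_mulgl (w : X) f : continuous f -> continuous (fun x => f (w * x)%g).
Proof.
move=> cf x; apply: continuous_comp; last exact: cf.
apply: (@mdist_continuous R X X) => r /(@mulg_uniform R X)[d d0 dP].
by exists d => // y z; exact: dP.
Qed.

Let mean_fm E f n : continuous f -> (0 < size E)%N ->
  \int[m]_x fm E f n x = \int[m]_x f x.
Proof.
move=> cf E0.
have ci w : m.-integrable setT (EFin \o (fun x : borel X => f (w * x)%g)).
  exact: (continuous_integrable (@compact_groupT R X) m (continuous_mulgl cf)).
have W0 : (0 < size (W E n))%N by rewrite size_words expn_gt0 E0.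
rewrite /fm /mean RintegralZl//.
  rewrite (@Rintegral_sum _ _ _ m _ _ (fun w (x : borel X) => f (w * x)%g))//.
  under eq_bigr do rewrite (integral_mulg mhaar)//.
  rewrite big_const_seq count_predT iter_addr_0 -[X in _ * X]mulr_natl mulKf//.
  by rewrite pnatr_eq0 -lt0n.
rewrite (_ : _ \o _ = fun x => (\sum_(w <- W E n) (f (w * x)%g)%:E)%E); last first.
  by apply/funext => x; rewrite /= sumEFin.
by apply: integrable_sum => // j _; exact: ci.
Qed.

(** Whatever [x] is, some letter [e] brings [e * x] near [1], so its term in the mean is within [r]
    of the constant [v]; only the other [N - 1] terms vary. Hence an oscillation [w] becomes at most
    [(1 - N^-1) * w + N^-1 * (2 * r)], a recursion with fixed point [2 * r]. *)
Let fm_bounds E f (r d : R) n : (0 < size E)%N -> (forall x, `|f x| <= 1) ->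
  (forall x x' y, mdist x x' < d -> `|f (y * x)%g - f (y * x')%g| <= r) ->
  (forall x x0, exists2 e, e \in E & mdist (e * x)%g x0 < d) ->
  exists b c, [/\ forall x, b <= fm E f n x <= c &
    c - b <= 2 * (1 - (size E)%:R^-1) ^+ n + 2 * r].
Proof.
move=> E0 f1 fd Ed.
have [e0 e0E _] := Ed 1%g 1%g.
have r0 : 0 <= r.
  have [|d0] := leP d 0.
    by move=> dle; have [y _ /lt_le_trans/(_ dle)] := Ed 1%g 1%g; rewrite ltNge mdist_ge0.
  by have := fd 1%g 1%g 1%g; rewrite mdistxx subrr normr0; exact.
set N := (size E)%:R : R; have N0 : 0 < N by rewrite ltr0n.
have NV : N^-1 <= 1 by rewrite invf_le1// ler1n.
elim: n => [|n [b [c [bc cb]]]].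
  exists (-1), 1; split; last by rewrite expr0; lra.
  by move=> x; rewrite /fm /mean/= invr1 mul1r big_seq1 mul1g -ler_norml.
have W0 : (0 < size (W E n))%N by rewrite size_words expn_gt0 E0.
have fmd x x' : mdist x x' < d -> `|fm E f n x - fm E f n x'| <= r.
  move=> xx'; rewrite /fm /mean -mulrBr -sumrB normrM ger0_norm ?invr_ge0//.
  rewrite ler_pdivrMl ?ltr0n//; apply: le_trans (ler_norm_sum _ _ _) _.
  rewrite mulr_natl -(count_predT (W E n)) -iter_addr_0 -big_const_seq.
  by apply: ler_sum => w _; exact: fd.
pose v := fm E f n 1%g.
exists ((1 - N^-1) * b + N^-1 * (v - r)), ((1 - N^-1) * c + N^-1 * (v + r)); split.
  move=> x; have [e eE ex] := Ed x 1%g.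
  have := fmd _ _ ex; rewrite ler_norml => /andP[v1 v2].
  have sumE : fm E f n.+1 x = N^-1 * (fm E f n (e * x)%g +
      \sum_(y <- rem e E) fm E f n (y * x)%g).
    by rewrite fmS /mean (big_rem e)/=.
  have sizeE : (size (rem e E))%:R = N - 1.
    by rewrite size_rem// -subn1 natrB.
  have S1 : (N - 1) * b <= \sum_(y <- rem e E) fm E f n (y * x)%g.
    rewrite -sizeE mulr_natl -(count_predT (rem e E)) -iter_addr_0 -big_const_seq.
    by apply: ler_sum => w _; case/andP: (bc (w * x)%g).
  have S2 : \sum_(y <- rem e E) fm E f n (y * x)%g <= (N - 1) * c.
    rewrite -sizeE mulr_natl -(count_predT (rem e E)) -iter_addr_0 -big_const_seq.
    by apply: ler_sum => w _; case/andP: (bc (w * x)%g).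
  have E1 z : (1 - N^-1) * z = N^-1 * ((N - 1) * z).
    by rewrite mulrA mulrBr mulVf ?gt_eqF// mulr1.
  rewrite sumE !E1 -!mulrDr.
  by apply/andP; split; rewrite ler_pM2l ?invr_gt0// /v; lra.
rewrite exprS.
have N1 : 0 <= 1 - N^-1 by rewrite subr_ge0.
have := ler_wpM2l N1 cb; rewrite !mulrDr.
set p := (1 - N^-1) ^+ n; set i := N^-1.
have -> : (1 - i) * (2 * p) = 2 * ((1 - i) * p) by rewrite mulrCA.
set z := (1 - i) * p.
move=> H; nra.
Qed.

(* Doeblin's argument: if the [N]-point set [E] is dense at a fixed scale,
   convolving by the uniform measure on [E] contracts the oscillation by
   [1 - 1/N], up to that scale. *)
Lemma doeblin (d : R) : 0 < d -> exists2 d0, 0 < d0 & forall N, exists n, forall E,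
  (0 < size E <= N)%N -> (forall z, exists2 e, e \in E & mdist z e < d0) ->
  forall f r, continuous f -> (forall x, `|f x| <= 1) ->
    (forall x x', mdist x x' < d -> `|f x - f x'| <= r) ->
    `|mean (W E n) f - \int[m]_x f x| <= 2 * r + d.
Proof.
move=> d0; have [d1 d10 d1P] := @mulg_uniform R X d d0.
have [d2 d20 d2P] := @divg_uniform R X d1 d10.
exists d2 => // N.
(* The length depends on [N] only, through a rate that bounds those of all sizes up to [N]; [N.+1]
   keeps it below [1] also for [N = 0]. *)
have [n nP] : exists n, 2 * (1 - N.+1%:R^-1) ^+ n < d.
  have : 2 * (1 - N.+1%:R^-1 : R) ^+ n @[n --> \oo] --> (2 * 0 : R).
    apply: cvgMr; apply: cvg_expr.
    by rewrite ger0_norm ?subr_ge0 ?invf_le1 ?ler1n// gtrDl oppr_lt0 invr_gt0.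
  rewrite mulr0 => /cvgrPdist_lt/(_ d d0)[n _ /(_ n (leqnn n))].
  rewrite /= sub0r normrN => H; exists n.
  exact: le_lt_trans (ler_norm _) H.
exists n => E /andP[E0 EN] Ed f r cf f1 fr.
have [||b [c [bc cb]]] := @fm_bounds E f r d1 n E0 f1.
- by move=> x x' y xx'; apply: fr; exact: d1P.
- move=> x x0; have [e eE xe] := Ed (x0 * x^-1)%g; exists e => //.
  have := d2P e x^-1%g (x0 * x^-1)%g x^-1%g; rewrite mdistxx invgK mulgVK.
  by apply => //; rewrite metric_sym.
have i1 : b <= \int[m]_x f x <= c.
  rewrite -(mean_fm n cf E0).
  have cfm : continuous (fm E f n).
    move=> x; apply: cvgMr; apply: cvg_big => [|w _]; first exact: add_continuous.
    exact: continuous_mulgl.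
  have H1 := le_integral (@compact_groupT R X) m (@cst_continuous _ _ b) cfm
    (fun x => (andP (bc x)).1).
  have H2 := le_integral (@compact_groupT R X) m cfm (@cst_continuous _ _ c)
    (fun x => (andP (bc x)).2).
  by rewrite !Rintegral_prob_cst in H1 H2; rewrite H1 H2.
have i2 : b <= mean (W E n) f <= c.
  by have := bc 1%g; rewrite /fm; under eq_fun do rewrite mulg1.
have : (1 - (size E)%:R^-1) ^+ n <= (1 - N.+1%:R^-1) ^+ n :> R.
  apply: lerXn2r; rewrite ?nnegrE ?subr_ge0 ?invf_le1 ?ler1n ?ltr0n//.
  by rewrite lerD2l lerN2 lef_pV2 ?posrE ?ltr0n// ler_nat ltnW.
move: i1 i2 => /andP[? ?] /andP[? ?] ?.
by rewrite ler_norml; apply/andP; split; lra.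
Qed.

End doeblin.

Lemma real_uniform_continuity (R : realType) (Y : metricType R) (f : Y -> R) (e : R) :
  compact [set: Y] -> continuous f -> 0 < e ->
  exists2 d, 0 < d & forall x y, mdist x y < d -> `|f x - f y| < e.
Proof.
move=> cY cf e0; have [d d0 fd] := uniform_continuity cY cf e0.
by exists d => // x y xy; apply: fd; rewrite ballEmdist.
Qed.

(** * From dense lists of microstates to measures *)

Section haar_approximation.
Variables (R : realType) (X : compactMetricGroupType R) (mX : Prob R X).

(** The error has the form that [doeblin] delivers, [s] being the oscillation of [f] at scale [r]. A
    functional [I] covers both integrals and means over lists. *)
Definition haar_close (r : R) (I : (X -> R) -> R) := forall f s,
  continuous f -> (forall x, `|f x| <= 1) ->
  (forall x y : X, mdist x y < r -> `|f x - f y| <= s) ->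
  `|I f - \int[mX]_x f x| <= 2 * s + r.

Lemma haar_close_le r t I : r <= t -> haar_close r I -> haar_close t I.
Proof.
move=> rt HI f s cf f1 fs.
apply: (@le_trans _ _ (2 * s + r)); last by rewrite lerD2l.
by apply: HI => // x y xy; apply: fs; exact: lt_le_trans rt.
Qed.

(** Measures outside [O] that are ever closer would converge to [mX], because the oscillation of a
    fixed continuous function at scale [r] tends to [0] with [r]. *)
Lemma haar_close_nbhs (O : set (Prob R X)) : nbhs mX O ->
  exists n, forall nu : Prob R X,
    haar_close n.+1%:R^-1 (fun f => \int[nu]_x f x) -> O nu.
Proof.
move=> nO; apply: contrapT => nex.
have bad n : exists nu : Prob R X,
    haar_close n.+1%:R^-1 (fun f => \int[nu]_x f x) /\ ~ O nu.
  apply: contrapT => nnu; apply: nex; exists n => nu cnu; apply: contrapT => Onu.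
  by apply: nnu; exists nu.
pose nu n := projT1 (cid (bad n)).
have nuP n : haar_close n.+1%:R^-1 (fun f => \int[nu n]_x f x) /\ ~ O (nu n).
  by rewrite /nu; case: cid.
suff : nu @ \oo --> mX by move=> /(_ O nO)[n _ /(_ n (leqnn n))]; exact: (nuP n).2.
apply/prob_cvgP => f cf.
have [M0 fM0] := compact_bounded (@compact_groupT R X) cf.
(* [haar_close] only sees functions bounded by [1], hence the rescaling by [M]. *)
pose M := `|M0| + 1; have M_gt0 : 0 < M by rewrite ltr_wpDl.
have fM x : `|M^-1 * f x| <= 1.
  rewrite normrM ger0_norm; last by rewrite invr_ge0 ltW.
  rewrite ler_pdivrMl// mulr1.
  by rewrite (le_trans (fM0 x))// (le_trans (ler_norm _))// lerDl.
have cg : continuous (fun x => M^-1 * f x).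
  by move=> x; apply: cvgMr; exact: cf.
have intg (mu : Prob R X) : \int[mu]_x (M^-1 * f x) = M^-1 * \int[mu]_x f x.
  rewrite RintegralZl//.
  exact: (continuous_integrable (@compact_groupT R X) mu cf).
apply/cvgrPdist_le => eps eps0.
have eM0 : 0 < M^-1 * eps / 4 by rewrite divr_gt0// mulr_gt0// invr_gt0.
have [d d0 dP] := real_uniform_continuity (@compact_groupT R X) cg eM0.
have [n nP] := @invS_lt R (Num.min d (M^-1 * eps / 4)) ltac:(by rewrite lt_min d0).
exists n => // l /= nl; have := nP l nl; rewrite lt_min => /andP[ld le4].
have := (nuP l).1 _ (M^-1 * eps / 4) cg fM; rewrite !intg -mulrBr normrM.
rewrite ger0_norm; last by rewrite invr_ge0 ltW.
move=> /(_ _)/wrap[x y xy|H]; first exact/ltW/dP/(lt_trans xy).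
rewrite distrC -(@ler_pM2l _ M^-1) ?invr_gt0//.
apply: le_trans H _; move: le4 eM0; move: (M^-1 * eps) (l.+1%:R^-1) => t u.
by move=> ? ?; lra.
Qed.

End haar_approximation.

Section microstate_lists.
Variables (R : realType) (G : groupType) (e : nat -> G) (d : nat -> nat).
Variable sigma : forall k, G -> 'S_(d k).
Variables (X : compactMetricGroupType R) (a : G -> X -> X).
Hypothesis e_surj : forall g, exists i, e i = g.
Hypothesis a_algebraic : algebraic_action a.
Hypothesis d_gt0 : forall k, (0 < d k)%N.
Variables (mX : Prob R X).
Hypothesis mX_haar : haar mX.

Local Notation ms n phi := (microstate e sigma a n phi).

Definition microstates n k (Phi : seq ('I_(d k) -> X)) :=
  forall phi, phi \in Phi -> ms n phi.

Definition at_index k (j : 'I_(d k)) (Phi : seq ('I_(d k) -> X)) : seq X :=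
  [seq phi j | phi <- Phi].

Definition seq_mean (s : seq X) (f : X -> R) : R :=
  (size s)%:R^-1 * \sum_(x <- s) f x.

Definition haar_like n k (Phi : seq ('I_(d k) -> X)) :=
  [/\ (0 < size Phi)%N, microstates n Phi &
    1 - n.+1%:R^-1 <=
      unif R [set j | haar_close mX n.+1%:R^-1 (seq_mean (at_index j Phi))]].

Lemma haar_like_le n k (Phi : seq ('I_(d k) -> X)) :
  haar_like n.+1 Phi -> haar_like n Phi.
Proof.
have nn : n.+2%:R^-1 <= n.+1%:R^-1 :> R by rewrite lef_pV2 ?posrE// ler_nat.
move=> [Phi0 PhiM PhiH]; split => //.
  by move=> phi /PhiM; apply: microstate_le.
apply: le_trans (le_trans PhiH _); first by rewrite lerD2l lerN2.
by apply: le_unif => j /=; exact: haar_close_le.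
Qed.

(** [mu k] is uniform on a list chosen by [diagonal]; its marginal at [j] is then the uniform
    measure on the values of the list at [j]. *)
Lemma haar_like_measures :
  (forall n, \forall k \near \oo, exists Phi, haar_like n (k := k) Phi) ->
  exists mu : forall k, Prob R {ptws 'I_(d k) -> X},
    supported_on_microstates sigma a mu /\ locally_weakstar_cvg mu mX.
Proof.
move=> hex.
have [Phi0 Phi0P] := @diagonal (fun k => seq ('I_(d k) -> X)) (fun=> [::])
  (fun n k Phi => haar_like n Phi) (fun n k Phi => @haar_like_le n k Phi) hex.
pose one k : 'I_(d k) -> X := fun=> 1%g.
(* An empty list is never [haar_like], so this changes nothing for large [k]; it only makes the
   uniform measure defined at every [k]. *)
pose Phi k := if Phi0 k is [::] then [:: one k] else Phi0 k.
have PhiP n : \forall k \near \oo, haar_like n (Phi k).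
  by apply: filterS (Phi0P n) => k; rewrite /Phi; case: (Phi0 k) => // -[].
have Phi_gt0 k : (0 < size (Phi k))%N by rewrite /Phi; case: (Phi0 k).
pose mu k : Prob R {ptws 'I_(d k) -> X} :=
  empirical R (Phi_gt0 k) (fun i => nth (one k) (Phi k) i : {ptws 'I_(d k) -> X}).
exists mu; split.
  move=> g delta U delta0 oU Udiag.
  (* The two notions of microstate list the pair in opposite orders. *)
  pose V : set (X * X) := [set p | U (p.2, p.1)].
  have nV (x : X) : nbhs (x, x) V.
    have [[A B]/= [nA nB] AB] := open_nbhs_nbhs (conj oU (Udiag x)).
    by exists (B, A) => // -[y z] [/= By Az]; exact: AB.
  have [r r0 rV] := diagonal_mdist (@compact_groupT R X) nV.
  have [i0 i0g] := e_surj g.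
  have [n nP] := @invS_lt R (Num.min r delta) ltac:(by rewrite lt_min r0).
  have /nP := leq_maxl n i0; rewrite lt_min => /andP[mr md].
  apply: cvg_near_cst; apply: filterS (PhiP (maxn n i0)) => k [_ PhiM _].
  rewrite /mu empiricalE (_ : _ @^-1` _ = setT) ?unif_setT//.
  apply/seteqP; split => // i _ /=.
  have /PhiM phiM : nth (one k) (Phi k) i \in Phi k by rewrite mem_nth.
  have := microstate_unif_good d_gt0 (g := g) r0 rV _ phiM.
  move=> /(_ _)/wrap[|H]; first by exists i0; split => //; exact: leq_maxr.
  by apply: le_trans H; rewrite lerD2l lerN2 ltW.
move=> O nO; have [n0 n0P] := haar_close_nbhs nO.
apply/cvgrPdist_le => eps eps0; have [n1 n1P] := invS_lt eps0.
pose n := maxn n0 n1.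
have nn0 : n.+1%:R^-1 <= n0.+1%:R^-1 :> R.
  by rewrite lef_pV2 ?posrE// ler_nat ltnS leq_maxl.
apply: filterS (PhiP n) => k [_ _ PhiH].
rewrite ger0_norm ?subr_ge0 ?unif_le1// lerBlDr -lerBlDl.
have neps : 1 - eps <= 1 - n.+1%:R^-1.
  by rewrite lerD2l lerN2 ltW// n1P// leq_maxr.
apply: le_trans neps (le_trans PhiH _); apply: le_unif => j /= Hj; apply: n0P.
apply: haar_close_le nn0 _ => f s cf f1 fs.
rewrite (integral_marginal (@compact_groupT R X))// integral_empirical; last first.
  apply: (continuous_measurable (T := {ptws 'I_(d k) -> X})) => phi.
  apply: (@continuous_comp _ _ _ (fun phi : {ptws 'I_(d k) -> X} => phi j) f).
    exact: (@proj_continuous 'I_(d k) (fun=> X) j phi).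
  exact: cf.
have -> : (size (Phi k))%:R^-1 * \sum_(i < size (Phi k)) f (nth (one k) (Phi k) i j) =
    seq_mean (at_index j (Phi k)) f.
  by rewrite /seq_mean size_map big_map (big_nth (one k)) big_mkord.
exact: Hj.
Qed.

Definition fmul k (phi psi : 'I_(d k) -> X) : 'I_(d k) -> X :=
  fun j => (phi j * psi j)%g.

Definition fone k : 'I_(d k) -> X := fun=> 1%g.

Lemma microstate_fmul n : exists m, forall k (phi psi : 'I_(d k) -> X),
  ms m phi -> ms m psi -> ms n (fmul phi psi).
Proof.
have [m1 m1P] := microstate_div e sigma a_algebraic n.
have [m2 m2P] := microstate_div e sigma a_algebraic m1.
exists (maxn m1 m2) => k phi psi phim psim.
have -> : fmul phi psi = (fun j => phi j * (1 * (psi j)^-1)^-1)%g.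
  by apply/funext => j; rewrite mul1g invgK.
apply: m1P; first exact: (microstate_le (leq_maxl m1 m2)).
apply: m2P; last exact: (microstate_le (leq_maxr m1 m2)).
exact: microstate1.
Qed.

Lemma microstates_words n l : exists m, forall k (Phi : seq ('I_(d k) -> X)),
  microstates m Phi -> microstates n (words (@fmul k) (@fone k) Phi l).
Proof.
elim: l n => [|l ih] n.
  exists 0%N => k Phi _ phi /=; rewrite inE => /eqP->; exact: microstate1.
have [m1 m1P] := microstate_fmul n; have [m2 m2P] := ih m1.
exists (maxn m1 m2) => k Phi PhiM phi /= /allpairsP[[w x]/= [wW xPhi ->]].
apply: m1P.
  apply: m2P wW => psi /PhiM; apply: microstate_le; exact: leq_maxr.
by apply: microstate_le (PhiM _ xPhi); exact: leq_maxl.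
Qed.

Definition dense_at r k (Phi : seq ('I_(d k) -> X)) : set 'I_(d k) :=
  [set j | forall z, exists2 phi, phi \in Phi & mdist z (phi j) < r].

Lemma dense_haar_like n : exists2 r, 0 < r & forall N, exists m,
  forall k (Phi : seq ('I_(d k) -> X)), (0 < size Phi <= N)%N ->
    microstates m Phi -> 1 - n.+1%:R^-1 <= unif R (dense_at r Phi) ->
    exists Psi, haar_like n (k := k) Psi.
Proof.
have n0 : 0 < n.+1%:R^-1 :> R by rewrite invr_gt0.
have [r r0 rP] := doeblin mX_haar n0.
exists r => // N; have [l lP] := rP N; have [m mP] := microstates_words n l.
exists m => k Phi /andP[Phi0 PhiN] PhiM PhiD.
exists (words (@fmul k) (@fone k) Phi l); split.
- by rewrite size_words expn_gt0 Phi0.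
- exact: mP.
apply: le_trans PhiD _; apply: le_unif => j /= Dj f s cf f1 fs.
rewrite /at_index (@map_words _ _ _ (fun x y : X => x * y)%g _ 1%g)//.
apply: lP => //; first by rewrite size_map Phi0.
move=> z; have [phi phiPhi zphi] := Dj z.
by exists (phi j) => //; apply/mapP; exists phi.
Qed.

End microstate_lists.

Lemma count_lt (T : eqType) (p q : pred T) (s : seq T) c :
  subpred p q -> c \in s -> ~~ p c -> q c -> (count p s < count q s)%N.
Proof.
move=> pq + npc qc; elim: s => //= x s ih; rewrite inE => /predU1P[<-|/ih cs].
  by rewrite qc (negbTE npc) add0n add1n ltnS; exact: sub_count.
rewrite -addnS leq_add//; have := pq x.
by case: (p x) => // ->.
Qed.

(** * Maximal lists of microstates *)

Section maximal_lists.
Variables (R : realType) (G : groupType) (e : nat -> G) (d : nat -> nat).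
Variable sigma : forall k, G -> 'S_(d k).
Variables (X : compactMetricGroupType R) (a : G -> X -> X).
Hypothesis a_algebraic : algebraic_action a.
Hypothesis d_gt0 : forall k, (0 < d k)%N.
Variables (U : set_system nat) (UU : UltraFilter U).

Local Notation ms n phi := (microstate e sigma a n phi).
Local Notation mss n Phi := (microstates e sigma a n Phi).

Definition far r k (Phi : seq ('I_(d k) -> X)) (psi : 'I_(d k) -> X) : set 'I_(d k) :=
  [set j | forall phi, phi \in Phi -> r <= mdist (psi j) (phi j)].

Section net.
Variables (eps : R) (s : seq X).
Hypothesis s_net : forall x, exists2 c, c \in s & mdist c x < eps.

Definition hits k (Phi : seq ('I_(d k) -> X)) j : nat :=
  count (fun c => has (fun phi : 'I_(d k) -> X => mdist c (phi j) < eps) Phi) s.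

Definition mean_hits k (Phi : seq ('I_(d k) -> X)) : R :=
  (d k)%:R^-1 * \sum_(j < d k) (hits Phi j)%:R.

Lemma mean_hits_le k (Phi : seq ('I_(d k) -> X)) :
  0 <= mean_hits Phi <= (size s)%:R.
Proof.
apply/andP; split; first by rewrite mulr_ge0 ?invr_ge0// sumr_ge0.
rewrite -[leRHS](@mean_const R (d k))// ler_wpM2l ?invr_ge0//.
by apply: ler_sum => j _; rewrite ler_nat count_size.
Qed.

(** The net point within [eps] of [psi j] is newly hit: values at distance at least [2 * eps] from
    [psi j] cannot be within [eps] of it. *)
Lemma hits_far k (Phi Psi : seq ('I_(d k) -> X)) psi j :
  psi \in Psi -> far (2 * eps) Phi psi j ->
  (hits Phi j < hits (Phi ++ Psi) j)%N.
Proof.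
move=> psiP jfar; have [c cs cpsi] := s_net (psi j).
apply: (count_lt _ cs); first by move=> x /=; rewrite has_cat => ->.
  apply/hasPn => phi /jfar H; rewrite -leNgt.
  have := metric_triangle (psi j) c (phi j); rewrite metric_sym in cpsi.
  by move: H cpsi; lra.
by rewrite has_cat; apply/orP; right; apply/hasP; exists psi.
Qed.

Lemma mean_hits_far k (Phi Psi : seq ('I_(d k) -> X)) :
  mean_hits Phi + unif R [set j | exists2 psi, psi \in Psi & far (2 * eps) Phi psi j]
    <= mean_hits (Phi ++ Psi).
Proof.
rewrite /mean_hits unif_sum -mulrDr ler_wpM2l ?invr_ge0// -big_split/=.
apply: ler_sum => j _; rewrite -natrD ler_nat; case: asboolP => [[psi psiP jfar]|_].
  by rewrite addn1; exact: hits_far psiP jfar.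
by rewrite addn0; apply: sub_count => x /=; rewrite has_cat => ->.
Qed.

(** The size bound precedes the accuracy, so that the same [N] serves at every accuracy and failure
    occurs at a definite one. *)
Definition reach N t := forall n, \forall k \near U, exists Phi,
  [/\ (size Phi <= N)%N, mss n Phi & t <= mean_hits Phi (k := k)].

(* [N] and [Phi] almost realise the supremum of the mean number of balls of the
   net that a bounded number of microstates can hit; adding [Psi] to [Phi] hence
   hits few new balls. *)
Lemma maximal_lists_net : 0 < eps ->
  exists N, forall N', exists q, forall n, \forall k \near U,
    exists Phi : seq ('I_(d k) -> X), [/\ (size Phi <= N)%N, mss n Phi &
      forall Psi, (size Psi <= N')%N -> mss q Psi ->
      unif R [set j | exists2 psi, psi \in Psi & far (2 * eps) Phi psi j] <= eps].
Proof.
move=> eps0; pose S := [set t : R | exists N, reach N t].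
have S_sup : has_sup S.
  split.
    exists 0, 0%N => n; apply: nearW => k; exists [::]; split => //.
    by case/andP: (mean_hits_le ([::] : seq ('I_(d k) -> X))).
  exists (size s)%:R => t [N tN].
  have /filter_ex[k [Phi [_ _ tPhi]]] := tN 0%N.
  by rewrite (le_trans tPhi)//; case/andP: (mean_hits_le Phi).
(* One half is lost below the supremum, the other in exceeding it strictly. *)
have e20 : 0 < eps / 2 by rewrite divr_gt0.
have [t [N tN] supt] := sup_adherent e20 S_sup.
exists N => N'.
have : ~ reach (N + N') (sup S + eps / 2).
  move=> H; have := ub_le_sup S_sup.2 (ex_intro (fun N => reach N _) _ H).
  by rewrite gerDl leNgt e20.
(* The ultrafilter is needed here: not holding for most [k] becomes failing for most [k]. *)
move=> /existsNP[q]; set A := (A in ~ (nbhs U A)); move=> nA.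
have {nA} UA : U (~` A) by have [|] := in_ultra_setVsetC A UU.
exists q => n; have := tN (maxn n q); apply: filterS2 UA => k nAk.
move=> [Phi [PhiN PhiM tPhi]]; exists Phi; split => //.
  by move=> phi /PhiM; apply: microstate_le; exact: leq_maxl.
move=> Psi PsiN PsiM; rewrite leNgt; apply/negP => Psi_far; apply: nAk.
exists (Phi ++ Psi); split.
- by rewrite size_cat leq_add.
- move=> phi; rewrite mem_cat => /orP[/PhiM|/PsiM//].
  by apply: microstate_le; exact: leq_maxr.
- by have := mean_hits_far Phi Psi; lra.
Qed.

End net.

Lemma maximal_lists (eps : R) : 0 < eps ->
  exists N, forall N', exists q, forall n, \forall k \near U,
    exists Phi : seq ('I_(d k) -> X), [/\ (size Phi <= N)%N, mss n Phi &
      forall Psi, (size Psi <= N')%N -> mss q Psi ->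
      unif R [set j | exists2 psi, psi \in Psi & far (2 * eps) Phi psi j] <= eps].
Proof.
move=> eps0; have [s s_net] := finite_net (@compact_groupT R X) eps0.
apply: (@maximal_lists_net eps s) => // x.
by have [c cs] := s_net x; rewrite ballEmdist; exists c.
Qed.

Definition points k (Phi : seq ('I_(d k) -> X)) (j : 'I_(d k)) : set X :=
  [set x | exists2 phi, phi \in Phi & x = phi j].

Lemma far_le r k (Phi Psi : seq ('I_(d k) -> X)) psi :
  {subset Phi <= Psi} -> far r Psi psi `<=` far r Phi psi.
Proof. by move=> PhiPsi j jfar phi /PhiPsi; exact: jfar. Qed.

Lemma microstates_div n : exists m, forall k (Phi : seq ('I_(d k) -> X)),
  mss m Phi -> mss n [seq (fun j => phi j * (psi j)^-1)%g | phi <- Phi, psi <- Phi].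
Proof.
have [m mP] := microstate_div e sigma a_algebraic n; exists m => k Phi PhiM.
by move=> chi /allpairsP[[phi psi]/= [phiP psiP ->]]; apply: mP; exact: PhiM.
Qed.

(* [q] depends neither on [l] nor on [r]: for all the scales up to [l], [Phi]
   contains a maximal list of a size that was fixed beforehand.  A further
   maximal list absorbs the quotients of [Phi]. *)
Lemma group_like_lists (eps : nat -> R) : (forall i, 0 < eps i) ->
  exists q : nat -> nat, forall l r, 0 < r -> exists N, forall n,
    \forall k \near U, exists Phi : seq ('I_(d k) -> X),
    [/\ (0 < size Phi <= N)%N, mss n Phi,
      forall i, (i <= l)%N -> forall phi, ms (q i) phi ->
        unif R (far (2 * eps i) Phi phi) <= eps i &
      unif R [set j | ~ approx_subgroup r (points Phi j)] <= r].
Proof.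
move=> eps0.
pose N i := projT1 (cid (maximal_lists (eps0 i))).
have NP i : forall N', exists q, forall n, \forall k \near U,
    exists Phi : seq ('I_(d k) -> X), [/\ (size Phi <= N i)%N, mss n Phi &
      forall Psi, (size Psi <= N')%N -> mss q Psi ->
      unif R [set j | exists2 psi, psi \in Psi & far (2 * eps i) Phi psi j] <= eps i].
  by rewrite /N; case: cid.
pose q i := projT1 (cid (NP i 1%N)).
exists q => l r r0; have r20 : 0 < r / 2 by rewrite divr_gt0.
have level i n : \forall k \near U, exists Phi : seq ('I_(d k) -> X),
    [/\ (size Phi <= N i)%N, mss n Phi & forall phi, ms (q i) phi ->
        unif R (far (2 * eps i) Phi phi) <= eps i].
  rewrite /q; case: cid => /= qi /(_ n); apply: filterS => k [Phi [PhiN PhiM PhiP]].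
  exists Phi; split => // phi phiM; apply: le_trans (PhiP [:: phi] _ _) => //.
    by apply: le_unif => j jfar; exists phi => //; exact: mem_head.
  by move=> psi; rewrite inE => /eqP->.
have levels m : exists M, forall n, \forall k \near U, exists Phi : seq ('I_(d k) -> X),
    [/\ (size Phi <= M)%N, mss n Phi & forall i, (i < m)%N -> forall phi, ms (q i) phi ->
        unif R (far (2 * eps i) Phi phi) <= eps i].
  elim: m => [|m [M MP]]; first by exists 0%N => n; apply: nearW => k; exists [::].
  exists (M + N m)%N => n; apply: filterS2 (MP n) (level m n) => k.
  move=> [Phi [PhiN PhiM PhiP]] [Psi [PsiN PsiM PsiP]]; exists (Phi ++ Psi); split.
  - by rewrite size_cat leq_add.
  - by move=> phi; rewrite mem_cat => /orP[/PhiM|/PsiM].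
  move=> i; rewrite ltnS leq_eqVlt => /predU1P[->|im] phi phiM.
    apply: le_trans (PsiP _ phiM); apply/le_unif/far_le => psi psiPsi.
    by rewrite mem_cat psiPsi orbT.
  apply: le_trans (PhiP _ im _ phiM); apply/le_unif/far_le => psi psiPhi.
  by rewrite mem_cat psiPhi.
have [M MP] := levels l.+1; have [Ns NsP] := maximal_lists r20.
(* [Ns] was fixed before the number of test microstates, so [K] may count the absorbing list too:
   all the [K * K] quotients of [L], also those involving [Psi], end up near [Psi]. The successor is
   for the constant microstate [1], which makes [L] nonempty. *)
pose K := (M + Ns).+1; have [qs qsP] := NsP (K * K)%N.
have [m mP] := microstates_div qs.
exists K => n; apply: filterS2 (MP (maxn n m)) (qsP (maxn n m)) => k.
move=> [Phi [PhiN PhiM PhiP]] [Psi [PsiN PsiM PsiP]].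
pose L := @fone R d X k :: (Phi ++ Psi).
have LM : mss (maxn n m) L.
  move=> phi; rewrite inE mem_cat => /predU1P[->|/orP[/PhiM|/PsiM]//].
  exact: microstate1.
have LK : (size L <= K)%N by rewrite /= size_cat ltnS leq_add.
exists L; split => //.
- by move=> phi /LM; apply: microstate_le; exact: leq_maxl.
- move=> i il phi phiM; apply: le_trans (PhiP i _ _ phiM) => //.
  apply/le_unif/far_le => psi psiPhi.
  by rewrite inE mem_cat psiPhi orbT.
apply: (@le_trans _ _ (r / 2)); last by lra.
pose D := [seq (fun j => phi j * (psi j)^-1)%g | phi <- L, psi <- L].
apply: le_trans (PsiP D _ _); last 2 first.
- by rewrite size_allpairs leq_mul.
- by apply: mP => phi /LM; apply: microstate_le; exact: leq_maxr.
apply: le_unif => j /=; apply: contra_notP => nD x y [phi phiL ->] [psi psiL ->].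
apply: contrapT => nz; apply: nD; exists (fun j => phi j * (psi j)^-1)%g.
  by apply/allpairsP; exists (phi, psi).
move=> chi chiPsi; rewrite leNgt; apply/negP => chir; apply: nz.
exists (chi j).
  by exists chi => //; rewrite inE mem_cat chiPsi !orbT.
by move: chir; rewrite mulrC divfK ?pnatr_eq0.
Qed.

End maximal_lists.

Lemma exists_common_radius (R : realType) (P : nat -> R -> Prop) l :
  (forall i r t, 0 < r <= t -> P i t -> P i r) ->
  (forall i, exists2 r, 0 < r & P i r) ->
  exists2 r, 0 < r & forall i, (i <= l)%N -> P i r.
Proof.
move=> Pdec Pex; elim: l => [|l [r r0 rP]].
  by have [r r0 rP] := Pex 0%N; exists r => // i; rewrite leqn0 => /eqP->.
have [t t0 tP] := Pex l.+1.
have rt0 : 0 < Num.min r t by rewrite lt_min r0.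
exists (Num.min r t) => // i; rewrite leq_eqVlt => /predU1P[->|].
  by apply: Pdec tP; rewrite rt0 ge_min lexx orbT.
by rewrite ltnS => /rP; apply: Pdec; rewrite rt0 ge_min lexx.
Qed.

(** * Approximately equivariant families of closed subgroups *)

Section levels.
Variables (R : realType) (G : groupType) (e : nat -> G) (d : nat -> nat).
Variable sigma : forall k, G -> 'S_(d k).
Variables (X : compactMetricGroupType R) (a : G -> X -> X).
Hypothesis a_algebraic : algebraic_action a.
Hypothesis d_gt0 : forall k, (0 < d k)%N.
Variables (U : set_system nat) (UU : UltraFilter U).
Variables (r0 c0 : R).
Hypothesis r0_gt0 : 0 < r0.
Variable eps : nat -> R.
Hypothesis eps_gt0 : forall i, 0 < eps i.
Hypothesis eps_le : forall i l, (i <= l)%N -> eps l <= eps i.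

Local Notation ms n phi := (microstate e sigma a n phi).
Local Notation mss n Phi := (microstates e sigma a n Phi).

Hypothesis sparse : forall N, exists m, \forall k \near U,
  forall Phi : seq ('I_(d k) -> X), (0 < size Phi <= N)%N -> mss m Phi ->
    unif R (dense_at r0 Phi) < 1 - c0.

(** Each scale [i <= l] keeps its own tolerance and its own accuracy [q i], which a given sequence
    of microstates eventually meets; the other two conditions improve with [l]. *)
Definition level (q : nat -> nat) l k (Y : 'I_(d k) -> closedSubgroup X) :=
  [/\ forall i, (i <= l)%N -> forall phi, ms (q i) phi ->
        unif R [set j | 3 * eps i <= setdist (phi j) (Y j)] <= 2 * eps i,
      forall i, (i <= l)%N ->
        unif R [set j | eps l <=
            mdist (sub_act a_algebraic (e i) (Y j)) (Y (sigma k (e i) j))]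
          <= 3 * eps l &
      c0 - eps l <=
        unif R [set j | r0 / 2 <= mdist (Y j) (full_subgroup X)]].

(** Order of choices: the scale [r] from [l], the list size [N] from [r], the accuracy [m] of
    [sparse] from [N], and last the accuracy [n], so large that [N] exceptional sets of proportion
    [n.+1%:R^-1] fit into [t]. *)
Lemma levels : exists q, forall l, \forall k \near U, exists Y, level q l (k := k) Y.
Proof.
have [q qP] := group_like_lists e sigma a_algebraic d_gt0 UU eps_gt0.
exists q => l; set t := eps l; have t0 : 0 < t by exact: eps_gt0.
have ti i : (i <= l)%N -> t <= eps i by exact: eps_le.
have t80 : 0 < t / 8 by rewrite divr_gt0.
have [h h0 hP] : exists2 h, 0 < h & forall i, (i <= l)%N ->
    forall x y : X, mdist x y < h -> mdist (a (e i) x) (a (e i) y) < t / 8.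
  apply: exists_common_radius => [i r s /andP[_ rs] H x y xy|i].
    exact/H/(lt_le_trans xy).
  exact: mdist_uniform_continuity (@compact_groupT R X)
    (@act_continuous _ _ _ _ a_algebraic (e i)) t80.
(* [h] controls the images under the action, [t / 8] the triangle inequalities below, and [r0 / 2]
   lets density of [Y j] at scale [r0 / 2] yield density of the list at scale [r0]. *)
pose c := Num.min h (Num.min (t / 8) (r0 / 2)).
have c_gt0 : 0 < c by rewrite !lt_min h0 t80 divr_gt0.
have ch : c <= h by rewrite ge_min lexx.
have ct : c <= t / 8 by rewrite !ge_min lexx orbT.
have cr : c <= r0 / 2 by rewrite !ge_min lexx !orbT.
have [r1 r10 r1P] := @approx_subgroup_close R X c c_gt0.
pose r := Num.min r1 t; have r_gt0 : 0 < r by rewrite lt_min r10.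
have rt : r <= t by rewrite ge_min lexx orbT.
have [N NP] := qP l r r_gt0; have [m mP] := sparse N.
have tN0 : 0 < Num.min (t / 8) (t / N.+1%:R) by rewrite lt_min t80 divr_gt0.
have [n1 n1P] := invS_lt tN0; pose n := maxn (maxn n1 m) l.
have := n1P n; rewrite !leq_max leqnn/= => /(_ isT); rewrite lt_min => /andP[nt8 ntN].
apply: filterS2 (NP n) mP => k [Phi [/andP[Phi0 PhiN] PhiM Phifar Phigrp]].
move=> /(_ Phi); rewrite Phi0 PhiN => /(_ isT _)/wrap[|Phisparse].
  by move=> phi /PhiM; apply: microstate_le; rewrite !leq_max leqnn orbT.
pose good j := approx_subgroup r (points Phi j).
(* At the indices that are not good, a proportion of at most [r], any subgroup will do. *)
have Yex j : exists Y : closedSubgroup X, good j -> close c (points Phi j) Y.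
  have [gj|ngj] := pselect (good j); last by exists point.
  have [||Y YP] := r1P (points Phi j); last by exists Y.
    by case: (Phi) Phi0 => // phi s _; exists (phi j); exists phi => //; exact: mem_head.
  move=> x y /gj H /H[z Ez xyz]; exists z => //.
  by apply: lt_le_trans xyz _; rewrite ge_min lexx.
pose Y j := projT1 (cid (Yex j)).
have YP j : good j -> close c (points Phi j) (Y j) by rewrite /Y; case: cid.
exists Y; split.
- move=> i il phi phiM; have := ti i il => tij.
  apply: (@le_trans _ _ (eps i + r)); last by lra.
  apply: le_trans (lerD (Phifar i il phi phiM) Phigrp).
  apply: le_trans (unifU _ _ _); apply: le_unif => j /= jY.
  have [gj|] := pselect (good j); last by right.
  left => psi psiPhi; rewrite leNgt; apply/negP => phipsi.
  have [|y Yy psiy] := (YP j gj).1 (psi j); first by exists psi.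
  have := le_trans jY (setdist_le (phi j) Yy).
  have := metric_triangle (phi j) (psi j) y.
  by move: phipsi psiy ct; lra.
- move=> i il; rewrite -/t; set g := e i.
  pose bad (phi : 'I_(d k) -> X) : set 'I_(d k) :=
    [set j | n.+1%:R^-1 <= mdist (a g (phi j)) (phi (sigma k g j))].
  have badN : unif R [set j | exists2 phi, phi \in Phi & bad phi j] <= t.
    apply: le_trans (unif_exists (c := n.+1%:R^-1) _) _.
      move=> phi /PhiM; apply; rewrite (leq_trans il)//.
      by rewrite !leq_max leqnn orbT.
    apply: (@le_trans _ _ (N.+1%:R * n.+1%:R^-1)).
      by rewrite ler_wpM2r ?ler_nat// leqW.
    by rewrite -ler_pdivlMl// mulrC ltW.
  (* Three exceptional sets: some member of [Phi] is badly moved at [j], [j] is not good, or its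
     image is not good; a permutation preserves the proportion of the last. *)
  apply: (@le_trans _ _ (t + (r + r))); last by lra.
  apply: le_trans (lerD badN (lerD Phigrp _)); last first.
    by rewrite -(unif_perm R (sigma k g)) in Phigrp; exact: Phigrp.
  apply: le_trans (lerD (lexx _) (unifU _ _ _)).
  apply: le_trans (unifU _ _ _); apply: le_unif => j /= jY.
  have [?|nbad] := pselect (exists2 phi, phi \in Phi & bad phi j); first by left.
  have [gj|] := pselect (good j); last by right; left.
  have [gsj|] := pselect (good (sigma k g j)); last by right; right.
  have phij phi : phi \in Phi -> mdist (a g (phi j)) (phi (sigma k g j)) < t / 8.
    move=> phiP; apply: lt_trans nt8; rewrite ltNge; apply/negP => H.
    by apply: nbad; exists phi.
  have : close (t / 2) (sub_act a_algebraic g (Y j)) (Y (sigma k g j)).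
    split.
      move=> _ [y Yy <-]; have [_ [phi phiP ->] yphi] := (YP j gj).2 y Yy.
      have [|z Yz phiz] := (YP _ gsj).1 (phi (sigma k g j)); first by exists phi.
      exists z => //.
      have gy := hP i il y (phi j) (lt_le_trans yphi ch).
      have := metric_triangle (a g y) (a g (phi j)) z.
      have := metric_triangle (a g (phi j)) (phi (sigma k g j)) z.
      by move: gy (phij _ phiP) phiz ct; rewrite /g; lra.
    move=> z Yz; have [_ [phi phiP ->] zphi] := (YP _ gsj).2 z Yz.
    have [|y Yy phiy] := (YP j gj).1 (phi j); first by exists phi.
    exists (a g y); first by exists y.
    have gy := hP i il (phi j) y (lt_le_trans phiy ch).
    have := metric_triangle z (a g (phi j)) (a g y).
    have := metric_triangle z (phi (sigma k g j)) (a g (phi j)).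
    rewrite [mdist (phi _) (a _ _)]metric_sym.
    by move: gy (phij _ phiP) zphi ct; rewrite /g; lra.
  by move=> /close_mdist; lra.
rewrite -/t; have : c0 <= unif R (~` dense_at r0 Phi) by rewrite unifC// lerBrDl -lerBrDr ltW.
have : unif R (~` dense_at r0 Phi) <=
    unif R [set j | r0 / 2 <= mdist (Y j) (full_subgroup X)] + r.
  apply: le_trans (lerD (lexx _) Phigrp).
  apply: le_trans (unifU _ _ _); apply: le_unif => j /= nj.
  have [gj|] := pselect (good j); last by right.
  left; rewrite leNgt; apply/negP => /mdist_close[_ Yfull]; apply: nj => z.
  have [//|y Yy zy] := Yfull z.
  have [_ [phi phiP ->] yphi] := (YP j gj).2 y Yy.
  exists phi => //; have := metric_triangle z y (phi j).
  by move: zy yphi cr; lra.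
by lra.
Qed.

End levels.

(** * The two implications *)

Section invariant_limit.
Variables (R : realType) (G : groupType) (e : nat -> G) (d : nat -> nat).
Variable sigma : forall k, G -> 'S_(d k).
Variables (X : compactMetricGroupType R) (a : G -> X -> X).
Hypothesis e_surj : forall g, exists i, e i = g.
Hypothesis a_algebraic : algebraic_action a.
Hypothesis d_gt0 : forall k, (0 < d k)%N.
Variables (mX : Prob R X).
Hypothesis mX_haar : haar mX.

Local Notation ms n phi := (microstate e sigma a n phi).
Local Notation SX := (closedSubgroup X).

Let eps i : R := i.+1%:R^-1.

Let eps_gt0 i : 0 < eps i. Proof. by rewrite invr_gt0. Qed.

Let eps_le i l : (i <= l)%N -> eps l <= eps i.
Proof. by move=> il; rewrite lef_pV2 ?posrE// ler_nat. Qed.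

Let empirical_mean k (Y : 'I_(d k) -> SX) (f : SX -> R) : continuous f ->
  \int[empirical R (d_gt0 k) Y]_H f H = (d k)%:R^-1 * \sum_(j < d k) f (Y j).
Proof. by move=> cf; apply: integral_empirical; exact: continuous_measurable. Qed.

Variables (q s : nat -> nat) (Y : forall k, 'I_(d k) -> SX) (r0 c0 : R).
Hypotheses (r0_gt0 : 0 < r0) (c0_gt0 : 0 < c0).
Arguments Y : clear implicits.
Hypothesis s_mono : {homo s : l m / (l < m)%N}.
(** A larger [l'] is allowed because a second extraction of a subsequence will skip levels. *)
Hypothesis Y_level : forall l, exists2 l', (l <= l')%N &
  level e sigma a_algebraic r0 c0 eps q l' (Y (s l)).

Let s_ge l : (l <= s l)%N.
Proof. by elim: l => // l ih; apply: leq_ltn_trans ih _; exact: s_mono. Qed.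

Lemma level_cvg_setdist (phi : forall k, 'I_(d k) -> X) :
  topological_microstates sigma a phi ->
  (d (s l))%:R^-1 * \sum_(j < d (s l)) setdist (phi (s l) j) (Y (s l) j)
    @[l --> \oo] --> (0 : R).
Proof.
move=> /(@topological_microstatesP R G e d sigma X a e_surj d_gt0) phiP.
have [M dM] := mdist_bounded X.
apply/cvgrPdist_le => t t0.
(* The distance is at most [3 * eps m], except on a proportion [2 * eps m] of the indices, where [M]
   still bounds it. *)
have M0 : 0 < 3 + `|M| * 2 by rewrite ltr_wpDr// mulr_ge0.
have [m /(_ m (leqnn m)) mt] := invS_lt (divr_gt0 t0 M0).
have [k0 _ k0P] := phiP (q m).
exists (maxn m k0) => // l /=; rewrite geq_max => /andP[ml k0l].
have [l' ll' [dY _ _]] := Y_level l.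
have phiM : ms (q m) (phi (s l)) by apply: k0P => /=; exact: leq_trans k0l (s_ge l).
have := dY m (leq_trans ml ll') _ phiM.
rewrite sub0r normrN ger0_norm; last first.
  by rewrite mulr_ge0 ?invr_ge0// sumr_ge0// => j _; exact: setdist_ge0.
move=> H; apply: le_trans (mean_le (d_gt0 (s l)) (e := 3 * eps m) (M := M)
  (B := [set j | 3 * eps m <= setdist (phi (s l) j) (Y (s l) j)]) _ _ _) _.
- by rewrite mulr_ge0// ltW.
- move=> j; have [y Yy] := sub_neq0 (Y (s l) j).
  exact: le_trans (setdist_le (phi (s l) j) Yy) (dM _ _).
- by move=> j /= /negP; rewrite -ltNge => /ltW.
apply: (@le_trans _ _ ((3 + `|M| * 2) * eps m)).
  by rewrite [leRHS]mulrDl -[X in _ <= _ + X]mulrA lerD2l ler_wpM2l.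
by rewrite mulrC -ler_pdivlMr// ltW.
Qed.

Variable eta : Prob R SX.
Hypothesis eta_cvg : empirical R (d_gt0 (s l)) (Y (s l)) @[l --> \oo] --> eta.

Lemma level_limit_mean (f : SX -> R) : continuous f ->
  (d (s l))%:R^-1 * \sum_(j < d (s l)) f (Y (s l) j) @[l --> \oo] -->
    \int[eta]_H f H.
Proof.
move=> cf; move/prob_cvgP : eta_cvg => /(_ f cf).
apply: cvg_trans; apply: near_eq_cvg; apply: nearW => l /=.
by rewrite empirical_mean.
Qed.

(** Reindexing by the permutation [sigma (s l) g] leaves a mean unchanged, and at most indices the
    translate of [Y (s l) j] is near the subgroup at the permuted index. *)
Lemma level_limit_invariant : invariant a_algebraic eta.
Proof.
move=> g; have [i ig] := e_surj g.
have cg := @continuous_sub_act R X G a a_algebraic g.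
have cK := @compact_closedSubgroup R X.
have [eta' [eta'E eta'I]] := image_probability cg cK eta.
suff H : same_measure eta' eta by move=> A mA; rewrite -H// eta'E.
apply: (same_measure_integrals cK (@open_cozero R SX)) => f cf.
rewrite eta'I//.
have cfg : continuous (fun H => f (sub_act a_algebraic g H)).
  by move=> H; apply: continuous_comp; [exact: cg|exact: cf].
have c1 := level_limit_mean cfg; have c2 := level_limit_mean cf.
apply: (cvg_unique (@Rhausdorff R) c1).
have c3 : (fun l => (d (s l))%:R^-1 * \sum_(j < d (s l)) f (Y (s l) j) +
    ((d (s l))%:R^-1 * \sum_(j < d (s l)) f (sub_act a_algebraic g (Y (s l) j)) -
     (d (s l))%:R^-1 * \sum_(j < d (s l)) f (Y (s l) j)))
    @ \oo --> \int[eta]_H f H + 0.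
  apply: cvgD => //.
  have [M fM] := compact_bounded cK cf.
  apply/cvgrPdist_le => t t0; have t20 : 0 < t / 2 by rewrite divr_gt0.
  have [r r1 rP] := real_uniform_continuity cK cf t20.
  have M0 : 0 < 2 * `|M| * 3 + 1 by rewrite ltr_wpDl// !mulr_ge0.
  have tM0 : 0 < Num.min r (t / 2 / (2 * `|M| * 3 + 1)).
    by rewrite lt_min r1 !divr_gt0.
  have [m mP] := invS_lt tM0.
  exists (maxn m i) => // l /=; rewrite geq_max => /andP[ml il].
  have [l' ll' [_ invY _]] := Y_level l.
  have := mP l' (leq_trans ml ll'); rewrite lt_min -/(eps l') => /andP[lr lt].
  have := invY i (leq_trans il ll'); rewrite ig; set B := mkset _ => BP.
  rewrite sub0r normrN -mulrBr.
  rewrite [X in _ - X](reindex_inj (@perm_inj _ (sigma (s l) g)))/= -sumrB.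
  rewrite normrM ger0_norm ?invr_ge0//.
  apply: le_trans (ler_wpM2l _ (ler_norm_sum _ _ _)) _; first by rewrite invr_ge0.
  apply: le_trans (mean_le (d_gt0 (s l)) (e := t / 2) (M := 2 * `|M|) (B := B) _ _ _) _.
  - exact: ltW.
  - move=> j; apply: le_trans (ler_normB _ _) _.
    by rewrite mulr_natl mulr2n lerD// (le_trans (fM _))// ler_norm.
  - move=> j nBj; apply/ltW/rP; rewrite ltNge; apply/negP => H; apply: nBj.
    exact: ltW (lt_le_trans lr H).
  have B3 : `|2 * `|M| | * unif R B <= `|2 * `|M| | * (3 * eps l').
    by rewrite ler_wpM2l.
  rewrite [X in t / 2 + X](_ : _ = 2 * `|M| * unif R B); last first.
    by rewrite normrM normr_id ger0_norm.
  rewrite normrM normr_id ger0_norm// in B3.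
  have : (2 * `|M| * 3 + 1) * eps l' < t / 2 by rewrite mulrC -ltr_pdivlMr.
  rewrite mulrDl mul1r; have := eps_gt0 l'; rewrite -!mulrA in B3 *.
  by lra.
rewrite addr0 in c3; apply: cvg_trans c3; apply: near_eq_cvg; apply: nearW => l /=.
by rewrite addrC subrK.
Qed.

(** The distance to the full subgroup has integral [0] against the point mass, while Markov's
    inequality keeps its empirical means above [r0 / 2 * (c0 / 2)]. *)
Lemma level_limit_neq : ~ same_measure eta (point_mass R (full_subgroup X)).
Proof.
move=> etaE; have cK := @compact_closedSubgroup R X.
pose f (H : SX) : R := mdist H (full_subgroup X).
have cf : continuous f.
  have -> : f = (fun H => setdist H [set full_subgroup X]).
    by apply/funext => H; rewrite /setdist image_set1 inf1.
  by apply: continuous_setdist; exists (full_subgroup X).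
have If : \int[eta]_H f H = 0.
  rewrite (same_measure_integral f etaE) /Rintegral integral_dirac//.
    by rewrite diracT mul1e /f mdistxx.
  by apply/measurable_EFinP; exact: continuous_measurable.
have := level_limit_mean cf; rewrite If => c1.
have : r0 / 2 * (c0 / 2) <= 0.
  apply: (cvgr_to_ge c1).
  have [m mP] := invS_lt (divr_gt0 c0_gt0 (ltr0n R 2)).
  exists m => // l /= ml; have [l' ll' [_ _ YP]] := Y_level l.
  have := mP l' (leq_trans ml ll'); rewrite -/(eps l') => lc.
  apply: le_trans (unif_markov (f := fun j => f (Y (s l) j)) (r0 / 2) _); last first.
    by move=> j; exact: mdist_ge0.
  rewrite ler_pM2l ?divr_gt0//; apply: le_trans YP; lra.
by rewrite leNgt !mulr_gt0// invr_gt0.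
Qed.

End invariant_limit.

(** * From the absence of measures to an invariant random subgroup *)

Section no_measures.
Variables (R : realType) (G : groupType) (e : nat -> G) (d : nat -> nat).
Variable sigma : forall k, G -> 'S_(d k).
Variables (X : compactMetricGroupType R) (a : G -> X -> X).
Hypothesis e_surj : forall g, exists i, e i = g.
Hypothesis a_algebraic : algebraic_action a.
Hypothesis d_gt0 : forall k, (0 < d k)%N.
Variables (mX : Prob R X).
Hypothesis mX_haar : haar mX.

Lemma frequently_ultrafilter (A : set nat) :
  (forall N, exists2 k, (N <= k)%N & A k) ->
  exists U, [/\ UltraFilter U, \oo `<=` U & U A].
Proof.
move=> Aex; pose F := filter_from setT (fun N => [set k | (N <= k)%N /\ A k]).
have FF : ProperFilter F.
  apply: filter_from_proper; last by move=> N _; have [k Nk Ak] := Aex N; exists k.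
  apply: filter_from_filter; first by exists 0%N.
  move=> M N _ _; exists (maxn M N) => // k /= [].
  by rewrite geq_max => /andP[? ?] ?.
have [U [UU FU]] := ultraFilterLemma FF.
exists U; split => //.
  by move=> B [N _ NB]; apply: FU; exists N => // k [Nk _]; exact: NB.
by apply: FU; exists 0%N => // k [].
Qed.

Lemma invariant_subgroups :
  ~ (exists mu : forall k, Prob R {ptws 'I_(d k) -> X},
       supported_on_microstates sigma a mu /\ locally_weakstar_cvg mu mX) ->
  exists (eta : Prob R (closedSubgroup X))
         (Y : forall k, 'I_(d k) -> closedSubgroup X),
    [/\ invariant a_algebraic eta,
        ~ same_measure eta (point_mass R (full_subgroup X)) &
        forall phi : forall k, 'I_(d k) -> X,
          topological_microstates sigma a phi ->
          exists kl : nat -> nat,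
            [/\ {homo kl : l m / (l < m)%N},
                (fun l => empirical R (d_gt0 (kl l)) (Y (kl l))) @ \oo --> eta &
                (fun l => (d (kl l))%:R^-1 * \sum_(j < d (kl l))
                   setdist (phi (kl l) j) (Y (kl l) j))
                  @ \oo --> (0 : R)]].
Proof.
move=> nmu; pose eps i : R := i.+1%:R^-1.
have eps_gt0 i : 0 < eps i by rewrite invr_gt0.
have eps_le i l : (i <= l)%N -> eps l <= eps i.
  by move=> il; rewrite lef_pV2 ?posrE// ler_nat.
(* The accuracy [n0] that fails also gives the constant [c0 = eps n0]: a proportion above it of the
   indices is not dense. *)
have [n0 n0P] : exists n, ~ \forall k \near \oo,
    exists Phi, haar_like e sigma a mX n (k := k) Phi.
  apply: contrapT => nn; apply: nmu.
  apply: (haar_like_measures (mX := mX) e_surj d_gt0) => n.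
  by apply: contrapT => nP; apply: nn; exists n.
have [|U [UU ooU UA]] := @frequently_ultrafilter
    [set k | ~ exists Phi, haar_like e sigma a mX n0 (k := k) Phi].
  move=> N; apply: contrapT => nk; apply: n0P; exists N => // k /= Nk.
  by apply: contrapT => nPhi; apply: nk; exists k.
have [r0 r0_gt0 r0P] := @dense_haar_like R G e d sigma X a a_algebraic mX mX_haar n0.
have sparse N : exists m, \forall k \near U,
    forall Phi : seq ('I_(d k) -> X), (0 < size Phi <= N)%N ->
    microstates e sigma a m Phi -> unif R (dense_at r0 Phi) < 1 - eps n0.
  have [m mP] := r0P N; exists m; apply: filterS UA => k nPhi Phi PhiN PhiM.
  by rewrite ltNge; apply/negP => H; apply: nPhi; exact: mP H.
have [q qP] := levels a_algebraic d_gt0 UU r0_gt0 eps_gt0 eps_le sparse.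
have [|s [s_mono sP]] := @frequently_subsequence (fun l k =>
    exists Y, level e sigma a_algebraic r0 (eps n0) eps q l (k := k) Y).
  move=> l N.
  have UN : U [set k | (N <= k)%N] by apply: ooU; exact: nbhs_infty_ge.
  have /filter_ex[k [Nk Yk]] : U ([set k | (N <= k)%N] `&` [set k | exists Y,
      level e sigma a_algebraic r0 (eps n0) eps q l (k := k) Y]).
    exact: filterI UN (qP l).
  by exists k.
(* Off the range of [s] any value will do, since (ii) only concerns a subsequence; injectivity of
   [s] gives each [k] at most one level. *)
have Yex k : exists Y : 'I_(d k) -> closedSubgroup X, forall l, s l = k ->
    level e sigma a_algebraic r0 (eps n0) eps q l (k := k) Y.
  have [[l slk]|nl] := pselect (exists l, s l = k); last first.
    by exists (fun=> full_subgroup X) => l slk; exfalso; apply: nl; exists l.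
  have s_inj : injective s.
    by move=> i j sij; case: (ltngtP i j) => // /s_mono; rewrite sij ltnn.
  move: (sP l); rewrite slk => -[Y YP]; exists Y => l' sl'k.
  by have -> : l' = l by apply: s_inj; rewrite sl'k slk.
pose Y k := projT1 (cid (Yex k)).
have YP l : level e sigma a_algebraic r0 (eps n0) eps q l (Y (s l)).
  by rewrite /Y; case: cid => /= y; exact.
have [t [eta [t_mono t_cvg]]] := empirical_subsequence (fun l => d_gt0 (s l))
  (fun l => Y (s l)) (@compact_closedSubgroup R X) (@metric_hausdorff R (closedSubgroup X)).
have st_mono : {homo s \o t : l m / (l < m)%N} by move=> l m lm; exact/s_mono/t_mono.
have t_ge l : (l <= t l)%N.
  by elim: l => // l ih; apply: leq_ltn_trans ih _; exact: t_mono.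
have lev l : exists2 l', (l <= l')%N &
  level e sigma a_algebraic r0 (eps n0) eps q l' (Y ((s \o t) l)) by exists (t l).
exists eta, Y; split.
- exact: (level_limit_invariant e_surj lev t_cvg).
- exact: (level_limit_neq r0_gt0 (eps_gt0 n0) lev t_cvg).
move=> phi phiM; exists (s \o t); split => //.
exact: (level_cvg_setdist e_surj d_gt0 st_mono lev phiM).
Qed.

End no_measures.

(** Otherwise [w] is below [c], its mean minus [t], wherever all the [S i] hold. Elsewhere
    [w x <= M] while [c >= - t], so [w] is everywhere at most [c] plus [M + t] times the sum of the
    indicators of the complements; integrating gives a contradiction. *)
Lemma exists_above (R : realType) (T : ptopologicalType) (P : Prob R T)
    (w : borel T -> R) (s : seq nat) (S : nat -> set (borel T)) (M t : R) :
  measurable_fun setT w -> (forall x, 0 <= w x <= M) ->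
  (forall i, measurable (S i)) -> 0 < t ->
  (M + t) * (\sum_(i <- s) fine (P (~` S i))) < t ->
  exists x, (forall i, i \in s -> S i x) /\ \int[P]_x w x <= w x + t.
Proof.
move=> mw w0M mS t0 sumt; apply: contrapT => nx.
have intw_ge0 : 0 <= \int[P]_x w x by apply: Rintegral_ge0 => x _; case/andP: (w0M x).
have M0 : 0 <= M + t.
  by have /andP[? ?] := w0M point; rewrite addr_ge0 ?(ltW t0)//; lra.
have iw : P.-integrable setT (EFin \o w).
  apply: (bounded_integrable P (M := M)) => // x.
  by case/andP: (w0M x) => ? ?; rewrite ger0_norm.
pose h (i : nat) (x : borel T) : R := (M + t) * \1_(~` S i) x.
have ih i : P.-integrable setT (EFin \o h i).
  apply: (bounded_integrable P (M := M + t)).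
    by apply: measurable_funM => //; apply: measurable_indic; exact: measurableC.
  move=> x; rewrite /h indicE normrM ger0_norm//.
  by case: (_ \in _); rewrite ?normr1 ?normr0 ?mulr1 ?mulr0.
have isum : P.-integrable setT (EFin \o (fun x => \sum_(i <- s) h i x)).
  rewrite (_ : _ \o _ = fun x => (\sum_(i <- s) (h i x)%:E)%E); last first.
    by apply/funext => x; rewrite /= sumEFin.
  by apply: integrable_sum => // i _; exact: ih.
pose c := \int[P]_x w x - t.
have ic : P.-integrable setT (EFin \o (fun=> c)).
  by apply: (bounded_integrable P (M := `|c|)).
have h0 i x : 0 <= h i x by rewrite mulr_ge0.
have le_w x : w x <= c + \sum_(i <- s) h i x.
  have [Sx|/existsNP[i /not_implyP[is_ nSx]]] := pselect (forall i, i \in s -> S i x).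
    rewrite ler_wpDr ?sumr_ge0// leNgt; apply/negP => cw; apply: nx; exists x.
    by split => //; move: cw; rewrite /c => ?; lra.
  rewrite (big_rem i is_)/= /h indicE mem_set// mulr1.
  have : 0 <= \sum_(y <- rem i s) (M + t) * \1_(~` S y) x.
    by rewrite sumr_ge0// => j _; exact: h0.
  have /andP[_ ?] := w0M x; rewrite /c => ?; lra.
have : \int[P]_x w x <= c + (M + t) * \sum_(i <- s) fine (P (~` S i)).
  have -> : c + (M + t) * \sum_(i <- s) fine (P (~` S i)) =
      \int[P]_x (c + \sum_(i <- s) h i x).
    rewrite RintegralD// Rintegral_prob_cst (Rintegral_sum s ih) mulr_sumr.
    congr (_ + _); apply: eq_bigr => i _; rewrite /h RintegralZl//.
      rewrite /Rintegral integral_indic ?setIT//; exact: measurableC.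
    apply: (bounded_integrable P (M := 1)).
      by apply: measurable_indic; exact: measurableC.
    by move=> x; rewrite indicE; case: (_ \in _); rewrite ?normr1 ?normr0.
  apply: le_Rintegral => //.
  rewrite (_ : _ \o _ = (EFin \o (fun=> c)) \+ (EFin \o (fun x => \sum_(i <- s) h i x)))//.
  exact: integrableD.
by rewrite /c; lra.
Qed.

(** * Measures on microstates exclude the random subgroup *)

Section no_subgroups.
Variables (R : realType) (G : groupType) (e : nat -> G) (d : nat -> nat).
Variable sigma : forall k, G -> 'S_(d k).
Variables (X : compactMetricGroupType R) (a : G -> X -> X).
Hypothesis e_surj : forall g, exists i, e i = g.
Hypothesis a_algebraic : algebraic_action a.
Hypothesis d_gt0 : forall k, (0 < d k)%N.
Variables (mX : Prob R X).
Hypothesis mX_haar : haar mX.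
Local Notation SX := (closedSubgroup X).
Local Notation ms n phi := (microstate e sigma a n phi).

Definition mean_setdist (H : SX) : R := \int[mX]_x setdist x H.

Let continuous_setdistH (H : SX) : continuous (fun x : X => setdist x H).
Proof. exact/continuous_setdist/sub_neq0. Qed.

Lemma mean_setdist_lipschitz (mu : Prob R X) (H K : SX) :
  `|\int[mu]_x setdist x H - \int[mu]_x setdist x K| <= mdist H K.
Proof.
apply: (dist_integral (@compact_groupT R X) mu) => // x.
have := setdist_mdist x H K; have := setdist_mdist x K H.
rewrite (metric_sym K H) => ? ?.
by rewrite ler_norml; apply/andP; split; lra.
Qed.

Lemma continuous_mean_setdist : continuous mean_setdist.
Proof. by apply: lipschitz_continuous => H K; exact: mean_setdist_lipschitz. Qed.

(** Finitely many translates of [f], each moving a net point [c] to [x0], have a sum bounded below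
    by [f x0 / 2], and all have the same integral as [f]. *)
Lemma haar_open_gt0 (f : X -> R) x0 : continuous f -> (forall x, 0 <= f x) ->
  0 < f x0 -> 0 < \int[mX]_x f x.
Proof.
move=> cf f0 fx0; rewrite lt_neqAle eq_sym; apply/andP; split; last first.
  by apply: Rintegral_ge0 => x _; exact: f0.
apply/eqP => int0.
have cfy (y : X) : continuous (fun x => f (y * x)%g).
  move=> x; apply: continuous_comp; last exact: cf.
  by apply: (@mdist_continuous R X X) => r /(@mulg_uniform R X)[r1 r10 rP];
    exists r1 => // z w; exact: rP.
have ci (y : X) : mX.-integrable setT (EFin \o (fun x : borel X => f (y * x)%g)).
  exact: (continuous_integrable (@compact_groupT R X) mX (cfy y)).
have [r r0 rP] := real_uniform_continuity (@compact_groupT R X) cf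
  (divr_gt0 fx0 (ltr0n R 2)).
have [t t0 tP] := @mulg_uniform R X r r0.
have [s sP] := finite_net (@compact_groupT R X) t0.
pose g (x : X) := \sum_(c <- s) f (x0 * c^-1 * x)%g.
have gE : \int[mX]_x g x = 0.
  rewrite /g (@Rintegral_sum _ _ _ mX _ _ (fun c (x : borel X) => f (x0 * c^-1 * x)%g))//.
  by rewrite big1// => c _; rewrite (integral_mulg mX_haar)// int0.
have g_ge x : f x0 / 2 <= g x.
  have [c cs] := sP x; rewrite ballEmdist => cx.
  rewrite /g (big_rem c cs)/=; apply: (@le_trans _ _ (f (x0 * c^-1 * x)%g)); last first.
    by rewrite lerDl sumr_ge0.
  have : mdist x0 (x0 * c^-1 * x)%g < r.
    by have := tP (x0 * c^-1)%g c x cx; rewrite mulgVK.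
  move=> /rP; rewrite ltr_norml => /andP[_]; lra.
have cg : continuous g.
  by move=> x; apply: cvg_big => [|c _]; [exact: add_continuous|exact: cfy].
have := le_integral (@compact_groupT R X) mX (@cst_continuous _ _ (f x0 / 2)) cg g_ge.
by rewrite gE Rintegral_prob_cst leNgt divr_gt0.
Qed.

Lemma mean_setdist_gt0 (H : SX) : H <> full_subgroup X -> 0 < mean_setdist H.
Proof.
move=> HX; have [x0 nHx0] : exists x, ~ sub_set H x.
  apply: contrapT => nx; apply: HX; apply: sub_set_inj.
  by apply/seteqP; split => x //= _; apply: contrapT => nHx; apply: nx; exists x.
apply: (@haar_open_gt0 _ x0) => [|x|].
- exact: continuous_setdistH.
- exact: setdist_ge0.
- rewrite lt_neqAle setdist_ge0 andbT eq_sym; apply/eqP => x00.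
  by apply: nHx0; apply: setdist_eq0 x00; [exact: sub_neq0|exact: closed_sub].
Qed.

Lemma integral_mean_setdist_gt0 (eta : Prob R SX) :
  ~ same_measure eta (point_mass R (full_subgroup X)) ->
  0 < \int[eta]_H mean_setdist H.
Proof.
move=> etaX; have cK := @compact_closedSubgroup R X.
have F0 H : 0 <= mean_setdist H by apply: Rintegral_ge0 => x _; exact: setdist_ge0.
rewrite lt_neqAle eq_sym; apply/andP; split; last first.
  by apply: Rintegral_ge0 => H _; exact: F0.
apply/eqP => int0; apply: etaX.
have mF : measurable_fun setT (EFin \o (mean_setdist : borel SX -> R)).
  apply/measurable_EFinP; exact: (continuous_measurable continuous_mean_setdist).
have intE : (\int[eta]_H (mean_setdist H)%:E = 0)%E.
  by rewrite -EFin_Rintegral ?int0//; exact: continuous_mean_setdist.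
have X0 : (\int[eta]_(H in setT) `|(mean_setdist H)%:E| = 0)%E.
  by rewrite -[RHS]intE; apply: eq_integral => H _; rewrite gee0_abs// lee_fin.
have /(ae_eq_integral_abs eta measurableT mF) := X0.
pose E : set (borel SX) := ~` [set full_subgroup X].
(* By [mean_setdist_gt0] the singleton of the full subgroup is the zero set of a continuous
   function. *)
have mE : measurable E.
  have -> : E = ~` ((mean_setdist : borel SX -> R) @^-1` [set 0]).
    congr (~` _); apply/seteqP; split => H /=; last first.
      by move=> FH; apply: contrapT => /mean_setdist_gt0; rewrite FH ltxx.
    move=> ->; rewrite /mean_setdist -[RHS](Rintegral_prob_cst mX).
    apply: eq_Rintegral => x _; apply/eqP; rewrite eq_le setdist_ge0 andbT.
    by rewrite -(mdistxx x); exact: setdist_le.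
  apply: measurableC; rewrite -[X in measurable X]setTI.
  exact: (continuous_measurable continuous_mean_setdist).
move=> [B [mB etaB0 AB]].
have etaE : eta E = 0%E.
  apply/eqP; rewrite eq_le measure_ge0 andbT -etaB0; apply: le_measure; rewrite ?inE//.
  move=> H /mean_setdist_gt0 FH; apply: AB => /= /(_ I) [FH0].
  by rewrite FH0 ltxx in FH.
have sub0 (A : set (borel SX)) : measurable A -> A `<=` E -> eta A = 0%E.
  move=> mA AE; apply/eqP; rewrite eq_le measure_ge0 andbT -etaE.
  by apply: le_measure; rewrite ?inE.
move=> A mA; rewrite /point_mass/= diracE.
have [/set_mem AX|/negP nAX] := boolP (full_subgroup X \in A); last first.
  by rewrite sub0// => H AH HX; apply: nAX; rewrite inE -HX.
have := sub0 (~` A) (measurableC mA).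
rewrite (probability_setC eta mA) => H.
have {}H : (1 - eta A = 0)%E by apply: H => H' nA HX; apply: nA; rewrite HX.
have finA : eta A \is a fin_num by exact: fin_num_measure.
rewrite -(fineK finA) in H *; move/eqP : H.
by rewrite -EFinB eqe subr_eq0 => /eqP <-.
Qed.

Variable mu : forall k, Prob R {ptws 'I_(d k) -> X}.
Arguments mu : clear implicits.
Hypothesis mu_supp : supported_on_microstates sigma a mu.
Hypothesis mu_cvg : locally_weakstar_cvg mu mX.
Variable Y : forall k, 'I_(d k) -> SX.
Arguments Y : clear implicits.

Let v k (phi : 'I_(d k) -> X) : R :=
  (d k)%:R^-1 * \sum_(j < d k) setdist (phi j) (Y k j).

Let vm k : R := (d k)%:R^-1 * \sum_(j < d k) mean_setdist (Y k j).

Let v_measurable k : measurable_fun setT (@v k : borel {ptws 'I_(d k) -> X} -> R).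
Proof.
apply: (continuous_measurable (T := {ptws 'I_(d k) -> X})) => phi.
apply: cvgMr; apply: cvg_big => [|j _]; first exact: add_continuous.
apply: (@continuous_comp _ _ _ (fun phi : {ptws 'I_(d k) -> X} => phi j)
  (fun x => setdist x (Y k j))); last exact: continuous_setdistH.
exact: (@proj_continuous 'I_(d k) (fun=> X) j phi).
Qed.

(** A weak* neighbourhood controls finitely many functions, but [Y k j] can be any closed subgroup.
    The integrals are Lipschitz in [H], so a finite net of the compact space of subgroups is
    enough. *)
Let near_mean_setdist t : 0 < t -> nbhs mX [set nu : Prob R X |
  forall H : SX, `|\int[nu]_x setdist x H - mean_setdist H| < t].
Proof.
move=> t0; have t30 : 0 < t / 3 by rewrite divr_gt0.
have [s sP] := finite_net (@compact_closedSubgroup R X) t30.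
pose P (c : SX) (nu : Prob R X) := `|\int[nu]_x setdist x c - mean_setdist c| < t / 3.
have N1 : \forall nu \near nbhs mX, forall c, c \in s -> P c nu.
  apply: near_forall_mem => c cs.
  have idc : id @ nbhs mX --> mX by exact: cvg_id.
  move/prob_cvgP/(_ _ (@continuous_setdistH c))/cvgrPdist_lt/(_ _ t30) : idc.
  by apply: filterS => nu; rewrite /P distrC.
apply: filterS N1 => nu nuP H; have [c cs] := sP H; rewrite ballEmdist/= => cH.
have h1 := mean_setdist_lipschitz nu c H; have h2 := mean_setdist_lipschitz mX c H.
have h3 : `|\int[nu]_x setdist x c - mean_setdist c| < t / 3 := nuP c cs.
rewrite -/(mean_setdist c) -/(mean_setdist H) in h2.
move: h1 h2 h3; rewrite !ler_norml !ltr_norml => /andP[? ?] /andP[? ?] /andP[? ?].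
by apply/andP; split; move: cH; lra.
Qed.

(** The integral of [v] depends on the marginals alone. An index with marginal near [mX] loses at
    most [t / 2]; the others, of vanishing proportion, at most [M] each. *)
Let int_v t : 0 < t -> \forall k \near \oo, vm k <= \int[mu k]_phi v phi + t.
Proof.
move=> t0; have [M dM] := mdist_bounded X.
have M_ge0 : 0 <= M by exact: le_trans (mdist_ge0 point point) (dM point point).
have sM (x : X) (H : SX) : setdist x H <= M.
  by have [y Hy] := sub_neq0 H; exact: le_trans (setdist_le x Hy) (dM _ _).
have t20 : 0 < t / 2 by rewrite divr_gt0.
have := mu_cvg (near_mean_setdist t20).
have M10 : 0 < M + 1 by rewrite ltr_wpDl.
move/cvgrPdist_lt/(_ _ (divr_gt0 t20 M10)); apply: filterS => k /=.
set O := [set j | _] => kO.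
have bO : (M + 1) * unif R (~` O) < t / 2.
  rewrite mulrC -ltr_pdivlMr// unifC//; apply: le_lt_trans kO; exact: ler_norm.
have -> : \int[mu k]_phi v phi =
    (d k)%:R^-1 * \sum_(j < d k) \int[marginal j (mu k)]_x setdist x (Y k j).
  have ci j : (mu k).-integrable setT
      (EFin \o (fun phi : borel {ptws 'I_(d k) -> X} => setdist (phi j) (Y k j))).
    apply: (bounded_integrable (T := {ptws 'I_(d k) -> X}) (mu k) (M := M)).
      apply: (continuous_measurable (T := {ptws 'I_(d k) -> X})) => phi.
      apply: (@continuous_comp _ _ _ (fun phi : {ptws 'I_(d k) -> X} => phi j)
        (fun x => setdist x (Y k j))); last exact: continuous_setdistH.
      exact: (@proj_continuous 'I_(d k) (fun=> X) j phi).
    by move=> phi; rewrite ger0_norm ?setdist_ge0.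
  rewrite /v RintegralZl//; last first.
    rewrite (_ : _ \o _ = fun phi => (\sum_(j < d k) (setdist (phi j) (Y k j))%:E)%E); last first.
      by apply/funext => phi; rewrite /= sumEFin.
    by apply: integrable_sum => // j _; exact: ci.
  congr (_ * _); rewrite (@Rintegral_sum _ _ _ (mu k) _ _
    (fun j (phi : borel {ptws 'I_(d k) -> X}) => setdist (phi j) (Y k j)))//.
  apply: eq_bigr => j _.
  by rewrite (integral_marginal (@compact_groupT R X) j (mu k) (@continuous_setdistH (Y k j))).
rewrite -lerBlDl /vm -mulrBr -sumrB.
apply: le_trans (mean_le (d_gt0 k) (e := t / 2) (M := M) (B := ~` O) (ltW t20) _ _) _.
- move=> j; rewrite lerBlDr; apply: (@le_trans _ _ M).
    rewrite -[leRHS](Rintegral_prob_cst mX) /mean_setdist.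
    apply: (le_integral (@compact_groupT R X)) => //; exact: cst_continuous.
  by rewrite lerDl; apply: Rintegral_ge0 => x _; exact: setdist_ge0.
- move=> j /contrapT /(_ (Y k j)); rewrite distrC => /ltW.
  exact: le_trans (ler_norm _).
rewrite ger0_norm//; have := unif_ge0 R (~` O); move: bO; rewrite mulrDl mul1r.
by lra.
Qed.

(** The finitely many memberships in [U] that hold at [phi0] persist nearby, and further ones only
    raise the proportion. Being open, the set is Borel, as [exists_above] requires. *)
Let open_good_microstates k (g : G) (U : set (X * X)) (c : R) : open U ->
  open [set phi : {ptws 'I_(d k) -> X} |
    c <= unif R [set j | U (phi (sigma k g j), a g (phi j))]].
Proof.
move=> oU; rewrite openE => phi0 /= cphi0.
have cj j : continuous (fun phi : {ptws 'I_(d k) -> X} => phi j).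
  by move=> phi; exact: (@proj_continuous 'I_(d k) (fun=> X) j phi).
pose P j (phi : {ptws 'I_(d k) -> X}) := U (phi0 (sigma k g j), a g (phi0 j)) ->
    U (phi (sigma k g j), a g (phi j)).
have N1 : nbhs (phi0 : {ptws 'I_(d k) -> X})
    [set phi | forall j, j \in enum 'I_(d k) -> P j phi].
  apply: (@near_forall_mem _ _ _ (nbhs (phi0 : {ptws 'I_(d k) -> X})) P) => j _.
  have [Uj|nUj] := pselect (U (phi0 (sigma k g j), a g (phi0 j))); last first.
    by apply: nearW => phi Uj; exfalso; exact: nUj.
  have cvgU : (fun phi : {ptws 'I_(d k) -> X} => (phi (sigma k g j), a g (phi j))) @
      nbhs (phi0 : {ptws 'I_(d k) -> X}) --> (phi0 (sigma k g j), a g (phi0 j)).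
    apply: cvg_pair; first exact: cj.
    apply: (@continuous_comp _ _ _ (fun phi : {ptws 'I_(d k) -> X} => phi j) (a g)).
      exact: cj.
    exact: act_continuous.
  have nU : nbhs (phi0 : {ptws 'I_(d k) -> X}) [set phi : {ptws 'I_(d k) -> X} |
      U (phi (sigma k g j), a g (phi j))].
    exact: cvgU U (open_nbhs_nbhs (conj oU Uj)).
  by apply: (filterS _ nU) => phi Uphi _; exact: Uphi.
have : nbhs (phi0 : {ptws 'I_(d k) -> X}) [set phi : {ptws 'I_(d k) -> X} |
    c <= unif R [set j | U (phi (sigma k g j), a g (phi j))]]; last by [].
apply: (filterS _ N1) => phi phiP; apply: le_trans cphi0 _.
by apply: le_unif => j /=; apply: phiP; rewrite mem_enum.
Qed.

(** One [n.+1%:R^-1] is spent in [int_v], the other in [exists_above]. *)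
Lemma microstates_far_from : exists phi : forall k, 'I_(d k) -> X,
  topological_microstates sigma a phi /\
  forall n, \forall k \near \oo, vm k <= v (phi k) + 2 * n.+1%:R^-1.
Proof.
have [||phi phiP] := @diagonal (fun k => 'I_(d k) -> X) (fun k _ => 1%g)
  (fun n k phi => ms n phi /\ vm k <= v phi + 2 * n.+1%:R^-1); last first.
- exists phi; split => [|n]; last by apply: filterS (phiP n) => k [].
  apply/(@topological_microstatesP R G e d sigma X a e_surj d_gt0) => n.
  by apply: filterS (phiP n) => k [].
- move=> n; set t := n.+1%:R^-1; have t0 : 0 < t by rewrite invr_gt0.
  have [M dM] := mdist_bounded X.
  have M_ge0 : 0 <= M by exact: le_trans (mdist_ge0 point point) (dM point point).
  pose U : set (X * X) := [set p | mdist p.1 p.2 < t].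
  pose S k i : set (borel {ptws 'I_(d k) -> X}) := [set phi : {ptws 'I_(d k) -> X} |
    1 - t <= unif R [set j | U (phi (sigma k (e i) j), a (e i) (phi j))]].
  have Udiag x : U (x, x) by rewrite /U/= mdistxx.
  have oU : open U.
    rewrite openE => -[x y] /= xyt; pose r := (t - mdist x y) / 2.
    have r0 : 0 < r by rewrite divr_gt0// subr_gt0.
    exists (ball x r, ball y r); first by split; exact: nbhsx_ballx.
    move=> [z w] [] /=; rewrite !ballEmdist /U/= => xz yw.
    have := metric_triangle z x w; have := metric_triangle x y w.
    by rewrite (metric_sym z x); move: xz yw; rewrite /r; lra.
  have mS k i : measurable (S k i).
    apply: open_borel; exact: open_good_microstates.
  have muS i : fine (mu k (~` S k i)) @[k --> \oo] --> (0 : R).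
    have muSE k : fine (mu k (~` S k i)) = 1 - fine (mu k (S k i)).
      rewrite (probability_setC (mu k) (mS k i)) fineB// fin_num_measure//.
    under eq_fun do rewrite muSE.
    have -> : 0 = 1 - 1 :> R by rewrite subrr.
    apply: cvgB; first exact: cvg_cst.
    exact: fine_cvg (mu_supp (e i) t0 oU Udiag).
  (* Only the first [n.+1] elements of the enumeration are tested, so this is a finite sum of null
     sequences. *)
  have : (M + t) * \sum_(i <- iota 0 n.+1) fine (mu k (~` S k i)) @[k --> \oo]
      --> (M + t) * \sum_(i <- iota 0 n.+1) 0.
    by apply: cvgMr; apply: cvg_big => [|i _]; [exact: add_continuous|exact: muS].
  rewrite big1// mulr0 => /cvgr_lt/(_ _ t0); apply: filterS2 (int_v t0) => k kv kS.
  have [|phi [phiS phiv]] := exists_above (@v_measurable k) _ (mS k) t0 kS.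
    move=> phi; rewrite /v mulr_ge0 ?invr_ge0 ?sumr_ge0//=; last first.
      by move=> j _; exact: setdist_ge0.
    rewrite -[leRHS](@mean_const R (d k))// ler_wpM2l ?invr_ge0//; apply: ler_sum => j _.
    by have [y Hy] := sub_neq0 (Y k j); exact: le_trans (setdist_le (phi j) Hy) (dM _ _).
  exists phi; split; last by lra.
  move=> i il; have := phiS i; rewrite mem_iota/= ltnS => /(_ il).
  rewrite /S/= lerBlDr -lerBlDl -unifC//; apply: le_trans; apply: le_unif => j /=.
  by rewrite /U/= metric_sym leNgt => /negP.
- move=> n k phi [phiM vphi]; split; first exact: microstate_le phiM.
  apply: le_trans vphi _; rewrite lerD2l ler_wpM2l// lef_pV2 ?posrE// ler_nat.
  by [].
Qed.

Lemma no_invariant_subgroups (eta : Prob R SX) :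
  ~ same_measure eta (point_mass R (full_subgroup X)) ->
  (forall phi : forall k, 'I_(d k) -> X,
    topological_microstates sigma a phi ->
    exists kl : nat -> nat,
      [/\ {homo kl : l m / (l < m)%N},
          (fun l => empirical R (d_gt0 (kl l)) (Y (kl l))) @ \oo --> eta &
          (fun l => (d (kl l))%:R^-1 * \sum_(j < d (kl l))
             setdist (phi (kl l) j) (Y (kl l) j)) @ \oo --> (0 : R)]) -> False.
Proof.
move=> /integral_mean_setdist_gt0; set L := \int[eta]_H _ => L0 etaP.
have [phi [/etaP[s [s_mono s_cvg sv]] phiv]] := microstates_far_from.
have s_ge l : (l <= s l)%N.
  by elim: l => // l ih; apply: leq_ltn_trans ih _; exact: s_mono.
have vmL : vm (s l) @[l --> \oo] --> L.
  move/prob_cvgP : s_cvg => /(_ _ continuous_mean_setdist).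
  apply: cvg_trans; apply: near_eq_cvg; apply: nearW => l /=.
  by rewrite integral_empirical//; exact: (continuous_measurable continuous_mean_setdist).
have L40 : 0 < L / 4 by rewrite divr_gt0.
have [n /(_ n (leqnn n)) nL] := invS_lt L40.
have [N _ NP] := phiv n.
(* [vm] above [3 * L / 4] contradicts [phiv], as [v] is below [L / 4] and [2 * n.+1%:R^-1] below
   [L / 2]. *)
have /filter_ex[l [[/= vml vl] Nl]] : \forall l \near \oo,
    (L - L / 4 < vm (s l) /\ v (phi (s l)) < L / 4) /\ (N <= l)%N.
  apply: filterI; last exact: nbhs_infty_ge.
  apply: filterI; last exact: (cvgr_lt _ sv).
  by apply: (cvgr_gt _ vmL); rewrite gtrBl.
have := NP (s l) (leq_trans Nl (s_ge l)); rewrite /= => H.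
by move: H nL; move: (n.+1%:R^-1) => z ? ?; lra.
Qed.

End no_subgroups.

Theorem corollary5p3 (R : realType) (G : groupType)
    (G_countable : countable [set: G])
    (d : nat -> nat) (d_gt0 : forall k, (0 < d k)%N)
    (sigma : forall k, G -> 'S_(d k))
    (sigma_sofic : sofic_approximation R sigma)
    (X : compactMetricGroupType R) (a : G -> X -> X)
    (a_algebraic : algebraic_action a)
    (mX : Prob R X) (mX_haar : haar mX) :
  ~ (exists mu : forall k, Prob R {ptws 'I_(d k) -> X},
       supported_on_microstates sigma a mu /\ locally_weakstar_cvg mu mX)
  <->
  exists (eta : Prob R (closedSubgroup X))
         (Y : forall k, 'I_(d k) -> closedSubgroup X),
    [/\ invariant a_algebraic eta,
        ~ same_measure eta (point_mass R (full_subgroup X)) &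
        forall phi : forall k, 'I_(d k) -> X,
          topological_microstates sigma a phi ->
          exists kl : nat -> nat,
            [/\ {homo kl : l m / (l < m)%N},
                (fun l => empirical R (d_gt0 (kl l)) (Y (kl l))) @ \oo --> eta &
                (fun l => (d (kl l))%:R^-1 * \sum_(j < d (kl l))
                   setdist (phi (kl l) j) (Y (kl l) j))
                  @ \oo --> (0 : R)]].
Proof.
have [e e_surj] : exists e : nat -> G, forall g, exists i, e i = g.
  have /countable_injP[f f_inj] := G_countable.
  exists (fun n => if pselect (exists g, f g = n) is left H
    then projT1 (cid H) else 1%g).
  move=> g; exists (f g); case: pselect => [H|[]]; last by exists g.
  by case: cid => h /= fh; apply: f_inj; rewrite ?inE.
split.
  exact: (invariant_subgroups e_surj a_algebraic d_gt0 mX_haar).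
move=> [eta [Y [_ etaX etaP]]] [mu [mu_supp mu_cvg]].
exact: (no_invariant_subgroups e_surj a_algebraic mX_haar mu_supp mu_cvg etaX
  etaP).
Qed.
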